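(* Let $f\colon\mathbb T^d\to\mathbb C$, $\varepsilon,\delta>0$, let $\Gamma\subset\mathbb Z^d$ be a (finite) search space with $\Gamma\supset I_\delta:=\{\boldsymbol k\in\mathbb Z^d:|\hat f_{\boldsymbol k}|\ge\delta\}$, and let $r\in\mathbb N$ satisfy $$r\ge 4\Big(|I_\delta|+\frac1{\delta^2}\Big(\sum_{\boldsymbol k\notin I_\delta}|\hat f_{\boldsymbol k}|\Big)^2\Big)\Big(\log|I_\delta|+\log\frac1\varepsilon\Big).$$ 1. For $t=1,\dots,d$, let $\boldsymbol X_{\{t\}}^M$ be a rank-1 lattice that is reconstructing for $J_{\{t\}}:=\mathcal P_{\{t\}}(\Gamma)$ with probability $1-\varepsilon$, and let $\boldsymbol X_{\{t\}}\subset\boldsymbol X_{\{t\}}^M$ be an i.i.d. uniformly drawn subset with $$|\boldsymbol X_{\{t\}}|\ge 12|J_{\{t\}}|\Big(\log|J_{\{t\}}|+\log\Big(\frac{2r}\varepsilon\Big)\Big).$$ Further, let $\boldsymbol\Xi_{\{t\}}=\{\boldsymbol\xi^1,\dots,\boldsymbol\xi^r\}\subset\mathbb T^{d-1}$ be drawn i.i.d. uniformly at random. Using samples of $f$ in $\boldsymbol X_{\{t\}}\times\boldsymbol\Xi_{\{t\}}$ for $r$ least squares approximations, construct $I_{\{t\}}\subset J_{\{t\}}$ by thresholding, as specified in the context. Then $$J_{\{t\}}\supset I_{\{t\}}\supset\mathcal P_{\{t\}}(I_\delta)$$ with probability exceeding $1-3\varepsilon$. 2. For $t=2,\dots,d$,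 successively, let $\boldsymbol X_{\{1,\dots,t\}}^M$ be a rank-1 lattice that is reconstructing for $J_{\{1,\dots,t\}}:=(I_{\{1,\dots,t-1\}}\times I_{\{t\}})\cap\mathcal P_{\{1,\dots,t\}}(\Gamma)$ with probability $1-\varepsilon$, and let $\boldsymbol X_{\{1,\dots,t\}}\subset\boldsymbol X_{\{1,\dots,t\}}^M$ be an i.i.d. uniformly drawn subset with $$|\boldsymbol X_{\{1,\dots,t\}}|\ge 12|J_{\{1,\dots,t\}}|\Big(\log|J_{\{1,\dots,t\}}|+\log\Big(\frac{2r}\varepsilon\Big)\Big).$$ Further, let $\boldsymbol\Xi_{\{1,\dots,t\}}=\{\boldsymbol\xi^1,\dots,\boldsymbol\xi^r\}\subset\mathbb T^{d-t}$ be drawn i.i.d. uniformly at random. Using samples of $f$ in $\boldsymbol X_{\{1,\dots,t\}}\times\boldsymbol\Xi_{\{1,\dots,t\}}$ for $r$ least squares approximations, construct $I_{\{1,\dots,t\}}\subset J_{\{1,\dots,t\}}$ by thresholding, as specified in the context. Then, given that the previously constructed sets satisfy $I_{\{1,\dots,t-1\}}\supset\mathcal P_{\{1,\dots,t-1\}}(I_\delta)$ and $I_{\{t\}}\supset\mathcal P_{\{t\}}(I_\delta)$, $$J_{\{1,\dots,t\}}\supset I_{\{1,\dots,t\}}\supset\mathcal P_{\{1,\dots,t\}}(I_\delta)$$ with probability exceeding $1-3\varepsilon$. In particular, $I_{\{1,\dots,d\}}\supset I_\delta$ with probability exceeding $1-6d\varepsilon$.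
   Context: $\mathbb T=\mathbb R/\mathbb Z$ is the torus, and $\mathbb T^m$ carries the uniform (Haar) probability measure ($\mathbb T^0$ is a single point). The function $f$ is everywhere defined and square integrable, with Fourier coefficients $\hat f_{\boldsymbol k}=\langle f,\exp(2\pi\mathrm i\langle\boldsymbol k,\cdot\rangle)\rangle_{L_2}$, $\boldsymbol k\in\mathbb Z^d$; $\|\cdot\|_{L_2}$ and $\|\cdot\|_\infty$ are the $L_2$ and supremum norms on $\mathbb T^d$. For $\Lambda\subset\mathbb Z^d$, $P_\Lambda f=\sum_{\boldsymbol k\in\Lambda}\hat f_{\boldsymbol k}\exp(2\pi\mathrm i\langle\boldsymbol k,\cdot\rangle)$. For $\mathfrak u\subset\{1,\dots,d\}$, $\mathcal P_{\mathfrak u}(\Lambda)=\{(k_j)_{j\in\mathfrak u}:\boldsymbol k\in\Lambda\}\subset\mathbb Z^{|\mathfrak u|}$; in particular $\mathcal P_{\{t\}}(\Lambda)=\{k_t:\boldsymbol k\in\Lambda\}$. Rank-1 lattice in $\mathbb T^m$: for $\boldsymbol z\in\mathbb R^m$ and $M\in\mathbb N$, the point set $\{\frac1M(i\boldsymbol z\bmod M\mathbf 1): i=0,\dots,M-1\}=\{\boldsymbol x^1,\dots,\boldsymbol x^M\}$ (modulus entrywise). It is reconstructing for $K\subset\mathbb Z^m$ if $\frac1M\sum_{i=1}^M\exp(2\pi\mathrm i\langle\boldsymbol k,\boldsymbol x^i\rangle)=\delta_{\boldsymbol 0,\boldsymbol k}$ for all $\boldsymbol k\in\{\boldsymbol k'-\boldsymbol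 l':\boldsymbol k',\boldsymbol l'\in K\}$. The lattices may be randomly constructed; ''reconstructing with probability $1-\varepsilon$'' refers to that construction. I.i.d. drawn collections are counted with multiplicity, $|\boldsymbol X|$ being the number of draws. All separate random draws (lattices, subsamples, anchors, and different steps) are made independently, given the frequency sets constructed in previous steps. Construction of the sets. Let $\mathfrak u=\{t\}$ (part 1) or $\mathfrak u=\{1,\dots,t\}$ (part 2). For $\boldsymbol x\in\mathbb T^{|\mathfrak u|}$ and an anchor $\boldsymbol\xi\in\mathbb T^{d-|\mathfrak u|}$, $f(\boldsymbol x,\boldsymbol\xi)$ denotes the value of $f$ at the point whose components with index in $\mathfrak u$ are given by $\boldsymbol x$ and whose remaining components are given by $\boldsymbol\xi$ (samples in $\boldsymbol X_{\mathfrak u}\times\boldsymbol\Xi_{\mathfrak u}$ are understood in this way). For each of the $r$ anchors, the least squares approximation is $$S_{\boldsymbol X_{\mathfrak u}}f(\cdot,\boldsymbol\xi^i)=\arg\min_{g\in V}\sum_{\boldsymbol x\in\boldsymbol X_{\mathfrak u}}|g(\boldsymbol x)-f(\boldsymbol x,\boldsymbol\xi^i)|^2=\sum_{\boldsymbol k\in J_{\mathfrak u}}\hat g_{\mathfrak u,\boldsymbol k}(\boldsymbol\xi^i)\exp(2\pi\mathrm i\langle\boldsymbol k,\cdot\rangle),\qquad V=\operatorname{span}\{\exp(2\pi\mathrm i\langle\boldsymbol k,\cdot\rangle)\}_{\boldsymbol k\in J_{\mathfrak u}}.$$ The constructed set consists of the detected frequencies $$I_{\mathfrak u}=\Big\{\boldsymbol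 k\in J_{\mathfrak u}:\max_{i=1,\dots,r}|\hat g_{\mathfrak u,\boldsymbol k}(\boldsymbol\xi^i)|\ge\delta'\Big\},$$ where the detection threshold $\delta'$ used in that step satisfies $$\delta'\le\frac{\delta}{\sqrt2}-4\|f-P_{I_\delta}f\|_{L_2}-2\|f-P_{\Lambda_{\mathfrak u}}f\|_\infty,\qquad \Lambda_{\mathfrak u}=\{\boldsymbol k\in\mathbb Z^d:(k_j)_{j\in\mathfrak u}\in J_{\mathfrak u}\}.$$ For $d=1$ or $t=1$ the two notations $I_{\{1\}}=I_{\{1,\dots,1\}}$ coincide. *)

(* Defs.v *)
From HB Require Import structures.
From mathcomp Require Import all_boot all_order all_algebra finmap.
From mathcomp Require Import all_classical all_reals all_analysis.
From mathcomp Require Export complex.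
Set Implicit Arguments.
Unset Strict Implicit.
Unset Printing Implicit Defensive.
Import Order.TTheory GRing.Theory Num.Theory.
Import ComplexField.Normc.
Local Open Scope classical_set_scope.
Local Open Scope ring_scope.

(** * The torus T^m = R^m / Z^m

   Points of T^m are represented by vectors of R^m; functions on T^m are the
   functions on R^m satisfying [torus_periodic]. *)

Definition torus_periodic (R : realType) (m : nat) (f : m.-tuple R -> R[i])
    : Prop :=
  forall x y : m.-tuple R,
    (forall j, tnth x j - tnth y j \is a Num.int) -> f x = f y.

Section haar_measure.
Variable R : realType.

Definition cons_pt (m : nat) (p : measurableTypeR R * m.-tuple R)
    : m.+1.-tuple R := [tuple of (p.1 : R) :: p.2].

Lemma measurable_cons_pt (m : nat) : measurable_fun [set: _] (@cons_pt m).
Proof.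
have m1 : measurable_fun [set: measurableTypeR R * m.-tuple R]
            (fun p => p.1 : R) by exact: measurable_fst.
exact: (measurable_cons m1 (@measurable_snd _ _ _ _)).
Qed.

HB.instance Definition _ (m : nat) :=
  isMeasurableFun.Build _ _ _ _ (@cons_pt m) (@measurable_cons_pt m).

(* Haar probability measure on T^m, as the m-fold product of the uniform
   distribution on the fundamental domain [0, 1]. *)
Fixpoint haar (m : nat) : probability (m.-tuple R) R :=
  match m return probability (m.-tuple R) R with
  | 0 => dirac [tuple]
  | m'.+1 => distribution
      (uniform_prob (@ltr01 R) \x haar m')%E (@cons_pt m' : {mfun _ >-> _})
  end.

End haar_measure.

(** * Fourier analysis *)

Section fourier.
Variables (R : realType) (m : nat).
Implicit Types (f g : m.-tuple R -> R[i]) (k : m.-tuple int) (x : m.-tuple R).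

(* exp(2 pi i <k, x>) *)
Definition expchar k x : R[i] :=
  let theta := 2 * pi * \sum_(j < m) (tnth k j)%:~R * tnth x j in
  (cos theta +i* sin theta)%C.

Definition cintegral f : R[i] :=
  ((\int[haar R m]_x complex.Re (f x)) +i*
   (\int[haar R m]_x complex.Im (f x)))%C.

Definition fourier_coef f k : R[i] :=
  cintegral (fun x => f x * ((expchar k x)^*)%C).

Definition L2norm f : \bar R :=
  Lnorm (haar R m) 2%:E (fun x => (normc (f x))%:E).

Definition supnorm f : \bar R := ereal_sup [set (normc (f x))%:E | x in setT].

Definition square_integrable f : Prop :=
  [/\ measurable_fun setT (fun x => complex.Re (f x)),
      measurable_fun setT (fun x => complex.Im (f x)) &
      (L2norm f < +oo)%E].

(* Unconditional sum of a real, resp. complex, family over a possibly infinite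
   set of frequencies; only meaningful for absolutely summable families. *)
Definition rsum (L : set (m.-tuple int)) (a : m.-tuple int -> R) : R :=
  fine (\esum_(k in L) (Num.max (a k) 0)%:E)
  - fine (\esum_(k in L) (Num.max (- a k) 0)%:E).

Definition csum (L : set (m.-tuple int)) (a : m.-tuple int -> R[i]) : R[i] :=
  (rsum L (fun k => complex.Re (a k)) +i*
   rsum L (fun k => complex.Im (a k)))%C.

(* P_L f. When log |I_delta| + log (1 / eps) > 0, [enough_anchors] forces the
   Fourier coefficients to be summable, so that P_L f is defined everywhere. *)
Definition fourier_proj (L : set (m.-tuple int)) f x : R[i] :=
  csum L (fun k => fourier_coef f k * expchar k x).

Definition large_freqs (delta : R) f : set (m.-tuple int) :=
  [set k | delta <= normc (fourier_coef f k)].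

Definition trig_poly (J : {fset m.-tuple int}) (c : m.-tuple int -> R[i]) x
    : R[i] :=
  \sum_(k <- J) c k * expchar k x.

(** ** Rank-1 lattices and least squares *)

Definition rmod (a b : R) : R := a - b * (Num.floor (a / b))%:~R.

Definition lattice_pt (M : nat) (z : m.-tuple R) (i : nat) : m.-tuple R :=
  [tuple (M%:R)^-1 * rmod (i%:R * tnth z j) M%:R | j < m].

Definition reconstructing (K : {fset m.-tuple int}) (M : nat) (z : m.-tuple R)
    : Prop :=
  forall k' l' : m.-tuple int, k' \in K -> l' \in K ->
  let k := [tuple tnth k' j - tnth l' j | j < m] in
  ((M%:R)^-1)%:C%C * (\sum_(i < M) expchar k (lattice_pt M z i))
    = (k == [tuple 0 | j < m])%:R.

(* The trigonometric polynomial on J with coefficients c minimizes the squared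
   residual of the data g at the points X, counted with multiplicity. *)
Definition least_squares (J : {fset m.-tuple int}) (X : seq (m.-tuple R)) g
    (c : m.-tuple int -> R[i]) : Prop :=
  forall c' : m.-tuple int -> R[i],
    \sum_(x <- X) normc (trig_poly J c x - g x) ^+ 2 <=
    \sum_(x <- X) normc (trig_poly J c' x - g x) ^+ 2.

End fourier.

(** * Coordinates in a subset u of {1, ..., d}

   'I_d is 0-based. An element of Z^u, resp. T^u, is a #|u|-tuple listing the
   coordinates with index in u, in increasing order of the index. *)

Section coordinates.
Variable d : nat.
Implicit Types u v w : {set 'I_d}.

Definition coord (T : Type) (x0 : T) u (x : #|u|.-tuple T) (j : 'I_d) : T :=
  nth x0 x (index j (enum u)).
Arguments coord {T} x0 u x j.

Definition freq_proj u (k : d.-tuple int) : #|u|.-tuple int :=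
  [tuple tnth k (enum_val i) | i < #|u|].

(* From Z^u to Z^v, meaningful for v \subset u. *)
Definition restrict_freq u v (k : #|u|.-tuple int) : #|v|.-tuple int :=
  [tuple coord 0 u k (enum_val i) | i < #|v|].
Arguments restrict_freq : clear implicits.

(* P_u(L) *)
Definition projection u (L : set (d.-tuple int)) : set (#|u|.-tuple int) :=
  freq_proj u @` L.

(* {k in Z^d : (k_j)_(j in u) in J} as a subset of Z^d *)
Definition cylinder u (J : {fset #|u|.-tuple int}) : set (d.-tuple int) :=
  [set k | freq_proj u k \in J].

(* The point of T^d denoted by (x, xi). *)
Definition merge_pt (R : realType) u (x : #|u|.-tuple R) (xi : #|~: u|.-tuple R)
    : d.-tuple R :=
  [tuple if j \in u then coord 0 u x j else coord 0 (~: u) xi j | j < d].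

(* {1, ..., n} *)
Definition seg (n : nat) : {set 'I_d} := [set j : 'I_d | (j < n)%N]%SET.

(* A x B, a subset of Z^u when u is the disjoint union of v and w, v preceding
   w. *)
Definition product_set u v w (A : {fset #|v|.-tuple int})
    (B : {fset #|w|.-tuple int}) : set (#|u|.-tuple int) :=
  [set k | (restrict_freq u v k \in A) && (restrict_freq u w k \in B)].

(* The steps in the order in which they are carried out: {1}, ..., {d}, and
   then {1,2}, ..., {1,...,d}. *)
Definition steps : seq {set 'I_d} :=
  [seq [set t]%SET | t : 'I_d <- enum 'I_d]
  ++ [seq seg t.+1 | t : 'I_d <- enum 'I_d & (0 < t)%N].

Definition earlier u : seq {set 'I_d} := take (index u steps) steps.

End coordinates.
Arguments coord {d T} x0 u x j.
Arguments restrict_freq {d} u v k.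
Arguments projection {d} u L.
Arguments merge_pt {d R} u x xi.
Arguments product_set {d} u v w A B.

(** * The random construction

   All the data of a run, as functions of the outcome w in Omega; the family is
   indexed by u, and only u in [steps d] matters. *)

Record construction (R : realType) (Omega : Type) (d r : nat) := Construction {
  (* the rank-1 lattice *)
  lat_size : {set 'I_d} -> Omega -> nat ;
  lat_gen : forall u : {set 'I_d}, Omega -> #|u|.-tuple R ;
  (* the indices, among 0, ..., lat_size - 1, of the drawn lattice points *)
  draws : {set 'I_d} -> Omega -> seq nat ;
  anchor : forall u : {set 'I_d}, 'I_r -> Omega -> #|~: u|.-tuple R ;
  (* the coefficients of the r least squares approximations *)
  coefs : forall u : {set 'I_d}, 'I_r -> Omega -> #|u|.-tuple int -> R[i] ;
  (* the threshold delta' *)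
  threshold : {set 'I_d} -> Omega -> R ;
  (* the sets J_u and I_u *)
  candidates : forall u : {set 'I_d}, Omega -> {fset #|u|.-tuple int} ;
  detected : forall u : {set 'I_d}, Omega -> {fset #|u|.-tuple int} }.
Arguments coefs {R Omega d r} X u i w k : rename.

Section construction_theory.
Variables (R : realType) (dOmega : measure_display).
Variables (Omega : measurableType dOmega) (P : probability Omega R).
Variables (d r : nat) (X : construction R Omega d r).
Implicit Types (u v : {set 'I_d}) (w : Omega) (t : 'I_d).

Definition samples u w : seq (#|u|.-tuple R) :=
  [seq lattice_pt (lat_size X u w) (lat_gen X u w) i | i <- draws X u w].

Definition random_construction : Prop :=
  forall u, u \in steps d ->
  [/\ forall M : nat, measurable [set w | lat_size X u w = M],
      measurable_fun setT (lat_gen X u),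
      forall s : seq nat, measurable [set w | draws X u w = s],
      forall i : 'I_r, measurable_fun setT (anchor X u i) &
      forall K : {fset #|u|.-tuple int},
        measurable [set w | detected X u w = K]].

(** ** Distribution of the draws *)

Definition history u (h : forall v, {fset #|v|.-tuple int}) : set Omega :=
  [set w | forall v, v \in earlier u -> detected X v w = h v].

Definition lattice_event u (M : nat) (B : set (#|u|.-tuple R)) : set Omega :=
  [set w | lat_size X u w = M /\ B (lat_gen X u w)].
Arguments lattice_event : clear implicits.

Definition draws_event u (s : seq nat) : set Omega :=
  [set w | draws X u w = s].

Definition anchors_event u (C : 'I_r -> set (#|~: u|.-tuple R)) : set Omega :=
  [set w | forall i, C i (anchor X u i w)].
Arguments anchors_event : clear implicits.

(* Given the sets detected in the earlier steps, the lattice and the number of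
   draws: the draws are i.i.d. uniform on the points of the lattice (indexed by
   0, ..., M - 1), the anchors are i.i.d. uniform, and both are independent. *)
Definition uniform_draws u : Prop :=
  forall h (M : nat) (B : set (#|u|.-tuple R)) (s : seq nat)
    (C : 'I_r -> set (#|~: u|.-tuple R)),
    measurable B -> all (fun i => (i < M)%N) s ->
    (forall i, measurable (C i)) ->
    P (history u h `&` lattice_event u M B
         `&` draws_event u s `&` anchors_event u C)
    = (P (history u h `&` lattice_event u M B
            `&` [set w | size (draws X u w) = size s])
       * ((M%:R)^-1 ^+ size s)%:E
       * \prod_(i < r) haar R #|~: u| (C i))%E.

(* Given the sets detected in the earlier steps, the draws of step u are
   independent of the draws of the earlier steps. The events below form
   pi-systems generating the sigma-algebras of the draws. *)
Definition independent_of_past u : Prop :=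
  forall h (M : {set 'I_d} -> nat) (B : forall v, set (#|v|.-tuple R))
    (s : {set 'I_d} -> seq nat)
    (C : forall v, 'I_r -> set (#|~: v|.-tuple R)),
    (forall v, measurable (B v)) -> (forall v i, measurable (C v i)) ->
    let E v := lattice_event v (M v) (B v)
                 `&` draws_event v (s v) `&` anchors_event v (C v) in
    let past := [set w | forall v, v \in earlier u -> E v w] in
    (P (history u h `&` past `&` E u) * P (history u h)
     = P (history u h `&` past) * P (history u h `&` E u))%E.

(* The lattice is reconstructing for J_u with probability 1 - eps, given the
   sets detected in the earlier steps. *)
Definition lattice_reconstructs (eps : R) u : Prop :=
  forall h, ((1 - eps)%:E * P (history u h) <=
    P (history u h `&`
       [set w | reconstructing (candidates X u w) (lat_size X u w)
                  (lat_gen X u w)]))%E.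

(** ** One step *)

Variables (f : d.-tuple R -> R[i]) (eps delta : R) (Gamma : {fset d.-tuple int}).

Definition enough_draws u : Prop := forall w,
  let J := #|` candidates X u w|%:R : R in
  12 * J * (ln J + ln (2 * r%:R / eps)) <= (size (draws X u w))%:R.

Definition thresholded u : Prop := forall w (k : #|u|.-tuple int),
  (k \in detected X u w) =
  (k \in candidates X u w) &&
  (threshold X u w <= \big[Num.max/0]_(i < r) normc (coefs X u i w k)).

Definition admissible_threshold u : Prop := forall w,
  let E2 := L2norm (fun x => f x - fourier_proj (large_freqs delta f) f x) in
  let Einf := supnorm
    (fun x => f x - fourier_proj (cylinder (candidates X u w)) f x) in
  ((threshold X u w)%:E <= (delta / Num.sqrt 2)%:E - 4%:E * E2 - 2%:E * Einf)%E.

Definition valid_step u : Prop :=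
  [/\ [/\ forall w, (0 < lat_size X u w)%N,
          forall w, all (fun i => (i < lat_size X u w)%N) (draws X u w),
          lattice_reconstructs eps u,
          uniform_draws u &
          independent_of_past u],
      enough_draws u,
      forall w i, least_squares (candidates X u w) (samples u w)
        (fun x => f (merge_pt u x (anchor X u i w))) (coefs X u i w),
      thresholded u &
      admissible_threshold u].

Definition step_part1 t : Prop :=
  (forall w, [set` candidates X [set t]%SET w] =
     projection [set t]%SET [set` Gamma])
  /\ valid_step [set t]%SET.

(* For t : 'I_d with 0 < t: the step {1, ..., t+1}, using I_{1, ..., t} and
   I_{t+1} in 1-based numbering. *)
Definition step_part2 t : Prop :=
  (forall w, [set` candidates X (seg d t.+1) w] =
     product_set (seg d t.+1) (seg d t) [set t]%SET
       (detected X (seg d t) w) (detected X [set t]%SET w)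
     `&` projection (seg d t.+1) [set` Gamma])
  /\ valid_step (seg d t.+1).

Definition detects u : set Omega :=
  [set w | projection u (large_freqs delta f) `<=` [set` detected X u w]].

Definition success u : set Omega :=
  [set w | [set` detected X u w] `<=` [set` candidates X u w]] `&` detects u.

End construction_theory.

Definition cond_prob (R : realType) (dOmega : measure_display)
    (Omega : measurableType dOmega) (P : probability Omega R)
    (A B : set Omega) : R :=
  fine (P (A `&` B)) / fine (P B).

(* r >= 4 (|I_delta| + delta^-2 (sum_(k notin I_delta) |fhat_k|)^2)
         (log |I_delta| + log (1 / eps)), in the extended reals: the series
   may diverge, and log 0 = -oo. *)
Definition enough_anchors (R : realType) (d : nat) (f : d.-tuple R -> R[i])
    (eps delta : R) (r : nat) : Prop :=
  let I := large_freqs delta f in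
  let n := #|` fset_set I|%:R : R in
  (4%:E * (n%:E + ((delta ^+ 2)^-1)%:E
             * (\esum_(k in ~` I) (normc (fourier_coef f k))%:E) ^+ 2)
        * (lne n%:E + (ln (eps^-1))%:E)
   <= (r%:R : R)%:E)%E.

(* Main.v *)
(* Write f_k(xi) for the k-th Fourier coefficient of x |-> f (x, xi).  Given the
   sets detected earlier, a step can fail in three ways.

   The lattice is not reconstructing: probability at most eps.

   The drawn points are bad.  On a reconstructing lattice the vectors
   v_x = (exp (2 pi i <k, x>))_(k in J) satisfy E v_x v_x^* = 1, and a matrix
   Chernoff bound gives sum_x |<v_x, c>|^2 >= m / 4 * |c|^2 for all c, m being
   the number of draws.  By Golden-Thompson, E tr exp (- sum_x v_x v_x^* / |J|)
   shrinks by a fixed factor with every draw; here exp is replaced by the powers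
   (1 - . / 2^k)^(2^k), so that Golden-Thompson reduces to
   |tr (A B)^(2^k)| <= |tr A^(2^k) B^(2^k)| up to an error of order 2^-k.

   The anchors miss a frequency.  If k is the projection of an element of
   I_delta, then |f_k|_2 >= delta, while |f_k|_oo is controlled by |I_delta| and
   the sum of the small coefficients, so by Paley-Zygmund |f_k(xi)| is at least
   about delta / sqrt 2 with a probability that r anchors raise to
   1 - eps / |I_delta|.

   Otherwise least squares, being a projection, recovers f_k(xi) up to
   2 |f - P_Lambda f|_oo, which the threshold allows for. *)
Require Import Defs.
From mathcomp Require Import all_boot all_order all_algebra finmap.
From mathcomp Require Import all_classical all_reals all_analysis.
From mathcomp Require Import measurable_realfun.
From mathcomp Require Import ring lra.
Set Implicit Arguments.
Unset Strict Implicit.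
Unset Printing Implicit Defensive.
Import Order.TTheory GRing.Theory Num.Theory.
Import numFieldNormedType.Exports.
Import ComplexField.Normc.
Local Open Scope classical_set_scope.
Local Open Scope ring_scope.


(** * A matrix Chernoff bound *)

(** The draws are treated by counting. [uniform_draws] gives probabilities only for a fixed history,
    lattice size and list of draws, so the Chernoff bound is proved as a bound on the number of bad
    lists among the M^m lists of m indices, uniformly in the lattice; it is then transferred by
    summing over the countably many values of these discrete data, without conditional expectations.

    Powers with exponent 2^k have a second merit: repeated Cauchy-Schwarz for the trace replaces the
    spectral theorem, and an even power of a Hermitian matrix has nonnegative trace.

    The strict bound 3 eps leaves room for both approximations. The draws cost 3/4 eps, namely eps/2
    from the exponential bound and eps/4 from the finite powers. The anchors cost 9/8 eps instead of
    eps, because the Fourier series is truncated to a finite set. With eps for the lattice this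
    makes 23/8 eps. *)

Section trace_inequalities.
Variable C : numClosedFieldType.

Definition adjmx m n (A : 'M[C]_(m, n)) : 'M[C]_(n, m) := map_mx Num.conj A^T.
Local Notation "A ^!" := (adjmx A) .

Lemma adjmxK m n (A : 'M[C]_(m, n)) : A^!^! = A.
Proof. by apply/matrixP => i j; rewrite !mxE conjCK. Qed.

Lemma adjmxM m n p (A : 'M[C]_(m, n)) (B : 'M[C]_(n, p)) :
  (A *m B)^! = B^! *m A^!.
Proof. by rewrite /adjmx trmx_mul map_mxM. Qed.

Lemma adjmx1 n : (1%:M : 'M[C]_n)^! = 1%:M.
Proof. by rewrite /adjmx trmx1 map_mx1. Qed.

Lemma adjmxD m n (A B : 'M[C]_(m, n)) : (A + B)^! = A^! + B^!.
Proof. by rewrite /adjmx linearD map_mxD. Qed.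

Lemma adjmxZ m n a (A : 'M[C]_(m, n)) : (a *: A)^! = a^* *: A^!.
Proof. by rewrite /adjmx linearZ map_mxZ. Qed.

Lemma adjmxX n (A : 'M[C]_n) k : (A ^+ k)^! = A^! ^+ k.
Proof.
elim: k => [|k IH]; first by rewrite !expr0 adjmx1.
by rewrite exprS exprSr -!mulmxE adjmxM IH.
Qed.

Lemma fro_sum m n (A : 'M[C]_(m, n)) :
  \tr (A *m A^!) = \sum_i \sum_j `|A i j| ^+ 2.
Proof.
by apply: eq_bigr => i _; rewrite mxE; apply: eq_bigr => j _;
   rewrite !mxE -normCK.
Qed.

Lemma fro_ge0 m n (A : 'M[C]_(m, n)) : 0 <= \tr (A *m A^!).
Proof.
by rewrite fro_sum; apply: sumr_ge0 => i _; apply: sumr_ge0 => j _;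
   rewrite exprn_ge0.
Qed.

Lemma sum_CauchySchwarz (T : finType) (a b : T -> C) :
  `|\sum_t a t * b t| ^+ 2 <= (\sum_t `|a t| ^+ 2) * \sum_t `|b t| ^+ 2.
Proof.
have -> : (\sum_t `|a t| ^+ 2) * (\sum_t `|b t| ^+ 2)
        = \sum_s \sum_t `|a s| ^+ 2 * `|b t| ^+ 2.
  by rewrite mulr_suml; apply: eq_bigr => s _; rewrite mulr_sumr.
apply: (@le_trans _ _ ((\sum_t `|a t| * `|b t|) ^+ 2)).
  rewrite ler_pXn2r ?nnegrE //; last by apply: sumr_ge0 => t _; rewrite mulr_ge0.
  by apply: le_trans (ler_norm_sum _ _ _) _; apply: ler_sum => t _; rewrite normrM.
have -> : (\sum_t `|a t| * `|b t|) ^+ 2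
        = \sum_s \sum_t (`|a s| * `|b s|) * (`|a t| * `|b t|).
  by rewrite expr2 mulr_suml; apply: eq_bigr => s _; rewrite mulr_sumr.
(* Lagrange's identity: twice the difference of the two sides is the sum over s, t of (|a t| |b s| -
   |a s| |b t|)^2. *)
rewrite -subr_ge0 -(@pmulrn_lge0 _ _ 2) // mulr2n -sumrB.
rewrite [X in X + _](_ : _ = \sum_s \sum_t
    (`|a t| ^+ 2 * `|b s| ^+ 2 - `|a t| * `|b t| * (`|a s| * `|b s|))); last first.
  by rewrite [RHS]exchange_big /=; apply: eq_bigr => s _; rewrite sumrB.
rewrite -big_split /=; apply: sumr_ge0 => s _.
rewrite -sumrB -big_split /=; apply: sumr_ge0 => t _.
have -> : `|a t| ^+ 2 * `|b s| ^+ 2 - `|a t| * `|b t| * (`|a s| * `|b s|)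
  + (`|a s| ^+ 2 * `|b t| ^+ 2 - `|a s| * `|b s| * (`|a t| * `|b t|))
  = (`|a t| * `|b s| - `|a s| * `|b t|) ^+ 2 by ring.
by rewrite real_exprn_even_ge0 // rpredB // rpredM // normr_real.
Qed.

Lemma tr_CauchySchwarz m n (A B : 'M[C]_(m, n)) :
  `|\tr (A *m B^!)| ^+ 2 <= \tr (A *m A^!) * \tr (B *m B^!).
Proof.
rewrite !fro_sum !pair_bigA /=.
have -> : \tr (A *m B^!) = \sum_(p : 'I_m * 'I_n) A p.1 p.2 * (B p.1 p.2)^*.
  rewrite -(pair_bigA _ (fun i j => A i j * (B i j)^*)) /=.
  by apply: eq_bigr => i _; rewrite mxE; apply: eq_bigr => j _; rewrite !mxE.
apply: le_trans (sum_CauchySchwarz _ _) _.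
rewrite ler_wpM2l //; first by apply: sumr_ge0 => p _; rewrite exprn_ge0.
by apply: ler_sum => p _; rewrite norm_conjC.
Qed.

Lemma fro_mul_le m n p (A : 'M[C]_(m, n)) (B : 'M[C]_(n, p)) :
  \tr ((A *m B) *m (A *m B)^!) <= \tr (A *m A^!) * \tr (B *m B^!).
Proof.
rewrite !fro_sum mulr_suml; apply: ler_sum => i _.
rewrite [X in _ * X]exchange_big mulr_sumr; apply: ler_sum => j _ /=.
by rewrite mxE; apply: sum_CauchySchwarz.
Qed.

Lemma tr_mulXC n (A B : 'M[C]_n) k : \tr ((A * B) ^+ k) = \tr ((B * A) ^+ k).
Proof.
case: k => [|k]; first by rewrite !expr0.
have E j : A * (B * A) ^+ j = (A * B) ^+ j * A.
  elim: j => [|j IH]; first by rewrite !expr0 mulr1 mul1r.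
  by rewrite exprSr mulrA IH exprSr -!mulrA.
rewrite exprSr mulrA -E -[LHS]/(\tr (_ *m _)) mxtrace_mulC mulmxE mulrA.
by rewrite -exprS.
Qed.

Lemma tr_AB_sq_le n (A B : 'M[C]_n) (t : C) :
  \tr (A *m A^!) = t -> \tr (B *m B^!) = t -> `|\tr (A *m B^!)| <= t.
Proof.
move=> At Bt; have t0 : 0 <= t by rewrite -At fro_ge0.
have := tr_CauchySchwarz A B; rewrite At Bt -expr2.
by rewrite ler_pXn2r ?nnegrE.
Qed.

(* The powers of 2 in the Golden-Thompson inequality, together with Weyl's
   majorant inequality; each one feeds the induction step of the other. *)
Lemma tr_pow2_le n k :
  (forall A B : 'M[C]_n, A^! = A -> B^! = B ->
     `|\tr ((A * B) ^+ (2 ^ k))| <= `|\tr (A ^+ (2 ^ k) * B ^+ (2 ^ k))|) /\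
  (forall A : 'M[C]_n,
     `|\tr (A ^+ (2 ^ k.+1))| <= `|\tr ((A * A^!) ^+ (2 ^ k))|).
Proof.
elim: k => [|k [IHG IHW]].
  split=> [A B _ _|A]; first by rewrite !expr1.
  rewrite expn1 expn0 expr1 expr2 (ger0_norm (fro_ge0 A)).
  rewrite -{2}(adjmxK A); apply: tr_AB_sq_le => //.
  by rewrite adjmxK mxtrace_mulC.
split=> [A B hA hB|A].
  (* Weyl at level k replaces A B by A B B A; a cyclic shift turns this into A^2 B^2, and
     Golden-Thompson at level k applies to the squares. *)
  apply: le_trans (IHW _) _.
  have -> : (A * B)^! = B * A by rewrite -mulmxE adjmxM hA hB.
  have -> : \tr ((A * B * (B * A)) ^+ (2 ^ k)) = \tr ((A ^+ 2 * B ^+ 2) ^+ (2 ^ k)).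
    by rewrite -[A * B * _]mulrA tr_mulXC [RHS]tr_mulXC !expr2 !mulrA.
  rewrite expnS ![_ ^+ (2 * _)]exprM; apply: IHG.
    by rewrite adjmxX hA.
  by rewrite adjmxX hB.
have hP : (A^! * A)^! = A^! * A by rewrite -mulmxE adjmxM adjmxK.
have hQ : (A * A^!)^! = A * A^! by rewrite -mulmxE adjmxM adjmxK.
(* Let P and Q be the two products of A with its adjoint. Weyl for A^2 leads to tr (P Q)^(2^k);
   Golden-Thompson separates the powers of P and Q, and Cauchy-Schwarz recombines them since these
   powers have equal Frobenius norms. *)
rewrite expnS exprM; apply: le_trans (IHW _) _.
have -> : \tr ((A ^+ 2 * (A ^+ 2)^!) ^+ (2 ^ k))
        = \tr (((A^! * A) * (A * A^!)) ^+ (2 ^ k)).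
  by rewrite adjmxX !expr2 mulrA tr_mulXC !mulrA.
apply: le_trans (IHG _ _ hP hQ) _.
have eP : \tr ((A^! * A) ^+ (2 ^ k) *m ((A^! * A) ^+ (2 ^ k))^!)
         = \tr ((A * A^!) ^+ (2 ^ k.+1)).
  by rewrite adjmxX hP mulmxE -exprD addnn -mul2n -expnS tr_mulXC.
have eQ : \tr ((A * A^!) ^+ (2 ^ k) *m ((A * A^!) ^+ (2 ^ k))^!)
         = \tr ((A * A^!) ^+ (2 ^ k.+1)).
  by rewrite adjmxX hQ mulmxE -exprD addnn -mul2n -expnS.
have hQk : ((A * A^!) ^+ (2 ^ k))^! = (A * A^!) ^+ (2 ^ k) by rewrite adjmxX hQ.
rewrite -hQk.
apply: le_trans (tr_AB_sq_le eP eQ) _.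
by rewrite real_ler_norm // ger0_real // -eQ fro_ge0.
Qed.

(** Jensen's inequality for the spectral measure of X at the unit vector w, obtained without
    diagonalizing: Cauchy-Schwarz squares the exponent at each step from [X ^+ (2 ^ k)] to its
    square. *)
Lemma quad_pow2_le n (X : 'M[C]_n) (w : 'cV[C]_n) k :
  X^! = X -> \tr (w^! *m w) = 1 ->
  `|\tr (w^! *m X *m w)| ^+ (2 ^ k) <= `|\tr (w^! *m X ^+ (2 ^ k) *m w)|.
Proof.
move=> hX w1; elim: k => [|k IH]; first by rewrite !expr1.
rewrite expnSr [X in X <= _]exprM.
have hXk : (X ^+ (2 ^ k))^! = X ^+ (2 ^ k) by rewrite adjmxX hX.
apply: (@le_trans _ _ (`|\tr (w^! *m X ^+ (2 ^ k) *m w)| ^+ 2)).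
  by rewrite ler_pXn2r ?nnegrE ?exprn_ge0.
have := tr_CauchySchwarz (X ^+ (2 ^ k) *m w) w.
rewrite [\tr (w *m w^!)]mxtrace_mulC w1 mulr1.
rewrite [\tr (_ *m w *m w^!)]mxtrace_mulC.
rewrite [\tr (_ *m (_)^!)]mxtrace_mulC adjmxM hXk => le1.
have ge0 := le_trans (exprn_ge0 2 (normr_ge0 _)) le1.
rewrite -mulmxA; apply: le_trans le1 _.
have -> : X ^+ (2 ^ k * 2) = X ^+ (2 ^ k) *m X ^+ (2 ^ k).
  by rewrite mulmxE -exprD addnn -muln2.
by rewrite -(ger0_norm ge0) -!mulmxA.
Qed.

End trace_inequalities.


Local Notation "A ^!" := (adjmx A).

(** * Powers of nearby matrices in the maximal row sum norm *)

Section row_bounds.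
Variables (C : numClosedFieldType) (n : nat).
Implicit Types (X Y : 'M[C]_n) (c d : C).

(** A bound on the operator norm induced by the sup norm: it is submultiplicative and read off the
    entries, which suffices for the error terms. *)
Definition rowbnd X c := forall i, \sum_j `|X i j| <= c.

Lemma rowbndW X c d : c <= d -> rowbnd X c -> rowbnd X d.
Proof. by move=> cd Xc i; apply: le_trans cd. Qed.

Lemma rowbndD X Y c d : rowbnd X c -> rowbnd Y d -> rowbnd (X + Y) (c + d).
Proof.
move=> Xc Yd i; apply: le_trans (lerD (Xc i) (Yd i)).
by rewrite -big_split /=; apply: ler_sum => j _; rewrite mxE ler_normD.
Qed.

Lemma rowbndZ X c a : rowbnd X c -> rowbnd (a *: X) (`|a| * c).
Proof.
move=> Xc i; apply: le_trans (ler_wpM2l (normr_ge0 a) (Xc i)).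
by rewrite mulr_sumr; apply: ler_sum => j _; rewrite mxE normrM.
Qed.

Lemma rowbndN X c : rowbnd X c -> rowbnd (- X) c.
Proof. by move=> Xc i; under eq_bigr do rewrite mxE normrN. Qed.

Lemma rowbndM X Y c d : 0 <= d ->
  rowbnd X c -> rowbnd Y d -> rowbnd (X * Y) (c * d).
Proof.
move=> d0 Xc Yd i.
apply: (@le_trans _ _ (\sum_l \sum_j `|X i l| * `|Y l j|)).
  rewrite exchange_big; apply: ler_sum => j _; rewrite mxE.
  by apply: le_trans (ler_norm_sum _ _ _) _; apply: ler_sum => l _; rewrite normrM.
apply: le_trans (ler_wpM2r d0 (Xc i)); rewrite mulr_suml; apply: ler_sum => l _.
by rewrite -mulr_sumr ler_wpM2l.
Qed.

Lemma rowbnd1 : rowbnd 1 1.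
Proof.
move=> i; rewrite (bigD1 i) //= big1 => [|j ji].
  by rewrite mxE eqxx normr1 addr0.
by rewrite mxE eq_sym (negbTE ji) normr0.
Qed.

Lemma rowbndX X c k : 0 <= c -> rowbnd X c -> rowbnd (X ^+ k) (c ^+ k).
Proof.
move=> c0 Xc; elim: k => [|k IH]; first by rewrite !expr0; apply: rowbnd1.
by rewrite !exprS; apply: rowbndM; rewrite ?exprn_ge0.
Qed.

(** Telescoping, one factor at a time; c being at least 1, c^k dominates the shorter products that
    occur. *)
Lemma rowbnd_subX X Y c d k : 1 <= c -> 0 <= d ->
  rowbnd X c -> rowbnd Y c -> rowbnd (X - Y) d ->
  rowbnd (X ^+ k - Y ^+ k) (k%:R * c ^+ k * d).
Proof.
move=> c1 d0 Xc Yc XYd; have c0 : 0 <= c by apply: le_trans c1.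
elim: k => [|k IH].
  rewrite !expr0 subrr !mul0r => i.
  by under eq_bigr do rewrite mxE normr0; rewrite big1.
have -> : X ^+ k.+1 - Y ^+ k.+1 = X * (X ^+ k - Y ^+ k) + (X - Y) * Y ^+ k.
  by rewrite !exprS mulrBr mulrBl addrA subrK.
apply: (@rowbndW _ (c * (k%:R * c ^+ k * d) + d * c ^+ k)).
  rewrite -[k.+1]addn1 natrD mulrDl mulrDl exprD expr1.
  apply: lerD; first by rewrite le_eqVlt; apply/orP; left; apply/eqP; ring.
  by rewrite mul1r mulrC ler_wpM2r // ler_peMr // exprn_ge0.
apply: rowbndD; apply: rowbndM => //; last exact: rowbndX.
  by rewrite !mulr_ge0 // ?exprn_ge0.
by rewrite exprn_ge0.
Qed.

Lemma rowbnd_tr X c : rowbnd X c -> `|\tr X| <= n%:R * c.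
Proof.
move=> Xc; apply: le_trans (ler_norm_sum _ _ _) _.
apply: (@le_trans _ _ (\sum_(i < n) c)); last by rewrite sumr_const card_ord mulr_natl.
apply: ler_sum => i _; apply: le_trans (Xc i).
by rewrite (bigD1 i) //= lerDl sumr_ge0.
Qed.

End row_bounds.

Lemma sum_tupleS (V : nmodType) (T : finType) m (F : m.+1.-tuple T -> V) :
  \sum_s F s = \sum_i \sum_(s : m.-tuple T) F [tuple of i :: s].
Proof.
rewrite pair_bigA /=.
rewrite (reindex (fun p : T * m.-tuple T => [tuple of p.1 :: p.2])) //=.
exists (fun s => (thead s, [tuple of behead s])) => [[i s] _|s _] /=.
  by congr (_, _); apply/val_inj.
by rewrite [RHS]tuple_eta.
Qed.

(** * Traces of powers of a damped random Gram matrix *)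

Section random_gram.
Variables (C : numClosedFieldType) (N M : nat) (v : 'I_M -> 'cV[C]_N).
Hypothesis N0 : (0 < N)%N.
Hypothesis vnorm : forall i j, `|v i j 0| = 1.

Definition outer i : 'M[C]_N := v i *m (v i)^!.
Definition gram (s : seq 'I_M) : 'M[C]_N := \sum_(i <- s) outer i.

Lemma outer_adj i : (outer i)^! = outer i.
Proof. by rewrite /outer adjmxM adjmxK. Qed.

Lemma gram_adj s : (gram s)^! = gram s.
Proof.
rewrite /gram; elim: s => [|i s IH].
  by rewrite big_nil; apply/matrixP => i j; rewrite !mxE conjC0.
by rewrite big_cons adjmxD IH outer_adj.
Qed.

Lemma outerE i j l : outer i j l = v i j 0 * (v i l 0)^*.
Proof. by rewrite mxE big_ord1 !mxE. Qed.

Lemma outer_sq i : outer i * outer i = N%:R *: outer i.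
Proof.
rewrite -mulmxE /outer mulmxA -[_ *m _ *m v i]mulmxA.
have -> : (v i)^! *m v i = N%:R%:M.
  apply/matrixP => a b; rewrite !ord1 !mxE eqxx mulr1n.
  under eq_bigr do rewrite !mxE mulrC -normCK vnorm expr1n.
  by rewrite sumr_const card_ord.
by rewrite mul_mx_scalar -scalemxAl.
Qed.

Lemma rowbnd_outer i : rowbnd (outer i) N%:R.
Proof.
move=> j; under eq_bigr do rewrite outerE normrM norm_conjC !vnorm mulr1.
by rewrite sumr_const card_ord.
Qed.

Lemma rowbnd_gram s : rowbnd (gram s) ((size s)%:R * N%:R).
Proof.
rewrite /gram; elim: s => [|i s IH] /=.
  rewrite big_nil mul0r => j.
  by under eq_bigr do rewrite mxE normr0; rewrite big1.
rewrite big_cons -[(size s).+1]add1n natrD mulrDl mul1r.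
exact: rowbndD (rowbnd_outer i) IH.
Qed.

Section scale.
Variable k : nat.
Hypothesis k0 : (0 < k)%N.
Let K := (2 ^ k)%N.
Let Kr : C := K%:R.
Let a : C := (N%:R * Kr)^-1.

Let Kgt0 : 0 < Kr. Proof. by rewrite ltr0n expn_gt0. Qed.
Let Ngt0 : 0 < N%:R :> C. Proof. by rewrite ltr0n. Qed.
Let a0 : 0 <= a. Proof. by rewrite invr_ge0 mulr_ge0 // ltW. Qed.
Let Kge1 : 1 <= Kr. Proof. by rewrite ler1n expn_gt0. Qed.

(** Its power with exponent K = 2^k stands for exp (- gram s / N). The scale 1 / (N K) gives each
    rank-one term the eigenvalue 1 / K. *)
Definition damped s : 'M[C]_N := 1 - a *: gram s.
Local Notation Y i := (1 - a *: outer i).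

Lemma damped_adj s : (damped s)^! = damped s.
Proof.
rewrite /damped adjmxD adjmx1 -scaleNr adjmxZ gram_adj.
by rewrite rmorphN /= geC0_conj.
Qed.

Lemma damped1_adj i : (Y i)^! = Y i.
Proof.
by have := damped_adj [:: i]; rewrite /damped /gram big_seq1.
Qed.

(** Terms of first order cancel. The remainder is of order K^-2, so that after taking the K-th power
    the loss is still of order 1 / K. *)
Lemma damped_cons i s :
  damped (i :: s) - damped s * Y i = - ((a ^+ 2) *: (gram s * outer i)).
Proof.
rewrite /damped /gram big_cons -/(gram s) mulrBl !mulrBr !mul1r mulr1.
rewrite -!mulmxE -scalemxAl -scalemxAr scalerA -expr2 scalerDr.
set U := a *: outer i; set V := a *: gram s; set W := _ *: (_ *m _).
by apply/matrixP => p q; rewrite !mxE; ring.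
Qed.

Lemma rowbnd_damped s m : (size s <= m)%N -> rowbnd (damped s) (1 + m%:R / Kr).
Proof.
move=> sm; apply: rowbndD; first exact: rowbnd1.
apply: rowbndN; have := rowbndZ a (@rowbnd_gram s).
apply: rowbndW; rewrite ger0_norm //.
have -> : a * ((size s)%:R * N%:R) = (size s)%:R / Kr.
  by rewrite /a; field; rewrite !lt0r_neq0.
by rewrite ler_wpM2r ?invr_ge0 ?(ltW Kgt0) // ler_nat.
Qed.

Let err m : C := N%:R * (m%:R * (1 + m%:R / Kr) ^+ (2 * K) / Kr).

(** [damped (i :: s)] is first replaced by a product of two Hermitian factors, at the price [err m];
    [tr_pow2_le] then distributes the power over the factors. *)
Lemma tr_damped_cons_le i s m : (size s < m)%N ->
  `|\tr (damped (i :: s) ^+ K)| <= `|\tr (damped s ^+ K * Y i ^+ K)| + err m.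
Proof.
move=> sm.
have m0 : (0 < m)%N by apply: leq_ltn_trans sm.
have b0 : 0 <= m%:R / Kr by rewrite divr_ge0 ?ler0n // ltW.
pose b : C := 1 + m%:R / Kr; have b1 : 1 <= b by rewrite lerDl.
have Yb : rowbnd (Y i) b.
  have := @rowbnd_damped [:: i] m; rewrite /damped /gram big_seq1; exact.
have Xb := @rowbnd_damped s m (ltnW sm).
have Xb' := @rowbnd_damped (i :: s) m sm.
have bb : b <= b ^+ 2 by rewrite ler_eXnr.
have b20 : 0 <= b ^+ 2 by rewrite exprn_ge0 // (le_trans ler01).
have D : rowbnd (damped (i :: s) - damped s * Y i) (m%:R / Kr ^+ 2).
  rewrite damped_cons; apply: rowbndN.
  have := rowbndZ (a ^+ 2)
    (rowbndM (ler0n _ _) (@rowbnd_gram s) (rowbnd_outer i)).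
  apply: rowbndW; rewrite ger0_norm ?exprn_ge0 //.
  have -> : a ^+ 2 * ((size s)%:R * N%:R * N%:R) = (size s)%:R / Kr ^+ 2.
    by rewrite /a; field; rewrite ?lt0r_neq0.
  by rewrite ler_wpM2r ?invr_ge0 ?exprn_ge0 ?(ltW Kgt0) // ler_nat ltnW.
have Z := @rowbnd_subX _ _ (damped (i :: s)) (damped s * Y i) (b ^+ 2)
  (m%:R / Kr ^+ 2) K (le_trans b1 bb)
  (divr_ge0 (ler0n _ _) (exprn_ge0 _ (ltW Kgt0)))
  (rowbndW bb Xb') _ D.
have {}Z := rowbnd_tr (Z _).
have [GT _] := @tr_pow2_le C N k.
have {}GT := GT _ _ (damped_adj s) (damped1_adj i).
rewrite -(subrK (\tr ((damped s * Y i) ^+ K)) (\tr (damped _ ^+ K))) addrC.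
apply: le_trans (ler_normD _ _) _; apply: lerD; first exact: GT.
rewrite -raddfB /=; apply: le_trans (Z _) _.
  by apply: (rowbndM (le_trans ler01 b1)).
rewrite le_eqVlt /err -/b mulnC exprM; apply/orP; left; apply/eqP; congr (_ * _).
rewrite -exprM mulnC exprM -[K%:R]/Kr.
by field; rewrite lt0r_neq0.
Qed.

Let beta : C := (1 - (1 - Kr^-1) ^+ K) / N%:R.

(** As [outer i] is N times a projection, the powers stay in the span of 1 and [outer i], with
    eigenvalue (1 - 1/K)^j on [v i]. *)
Lemma damped1X i j :
  Y i ^+ j = 1 - ((1 - (1 - Kr^-1) ^+ j) / N%:R) *: outer i.
Proof.
elim: j => [|j IH]; first by rewrite !expr0 subrr mul0r scale0r subr0.
rewrite exprSr IH mulrBl !mulrBr !mul1r mulr1 -!mulmxE -scalemxAl -scalemxAr.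
rewrite mulmxE outer_sq !scalerA.
apply/matrixP => p q; rewrite !mxE exprS /a.
by field; rewrite !lt0r_neq0.
Qed.

(** For Hermitian X this exhibits the power as a positive semidefinite matrix, the property that an
    exponential would have for free. *)
Lemma even_pow n (X : 'M[C]_n) : X ^+ K = X ^+ (2 ^ k.-1) * X ^+ (2 ^ k.-1).
Proof. by rewrite -exprD addnn -mul2n -expnS prednK. Qed.

Lemma tr_damped_ge0 s : 0 <= \tr (damped s ^+ K).
Proof.
have h : (damped s ^+ (2 ^ k.-1))^! = damped s ^+ (2 ^ k.-1).
  by rewrite adjmxX damped_adj.
by rewrite even_pow -{2}h fro_ge0.
Qed.

Lemma tr_damped_mul_ge0 s i : 0 <= \tr (damped s ^+ K * Y i ^+ K).
Proof.
set P := damped s ^+ (2 ^ k.-1); set Q := Y i ^+ (2 ^ k.-1).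
have hP : P^! = P by rewrite adjmxX damped_adj.
have hQ : Q^! = Q by rewrite adjmxX damped1_adj.
rewrite !even_pow -/P -/Q.
have -> : \tr (P * P * (Q * Q)) = \tr ((Q * P) *m (Q *m P)^!).
  by rewrite adjmxM hP hQ -!mulmxE !mulmxA [LHS]mxtrace_mulC !mulmxA.
exact: fro_ge0.
Qed.

Hypothesis tight : \sum_i outer i = M%:R%:M.

Lemma sum_tr_damped_mul s :
  \sum_i \tr (damped s ^+ K * Y i ^+ K) = M%:R * (1 - beta) * \tr (damped s ^+ K).
Proof.
rewrite -raddf_sum -mulr_sumr /=.
under eq_bigr do rewrite damped1X -/beta.
rewrite sumrB sumr_const card_ord -scaler_sumr tight.
rewrite -scaler_nat -scalemx1 scalerA -scalerBl -mulmxE -scalemxAr mulmx1 linearZ /=.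
by congr (_ * _); ring.
Qed.

Lemma beta_bounds : 0 <= 1 - beta <= 1.
Proof.
have K1 : Kr^-1 <= 1 by rewrite invf_le1.
have q0 : 0 <= (1 - Kr^-1) ^+ K by rewrite exprn_ge0 // subr_ge0.
have q1 : (1 - Kr^-1) ^+ K <= 1.
  by rewrite exprn_ile1 // ?subr_ge0 // gerBl invr_ge0 ltW.
rewrite subr_ge0 gerBl /beta divr_ge0 ?subr_ge0 ?ler0n // andbT.
rewrite ler_pdivrMr // mul1r; apply: (@le_trans _ _ 1); last by rewrite ler1n.
by rewrite gerBl.
Qed.

(* [err m] is the loss incurred by replacing the Lie product formula by finite
   powers. *)
Lemma sum_tr_damped_le m p : (p <= m)%N ->
  \sum_(s : p.-tuple 'I_M) \tr (damped s ^+ K) <=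
  M%:R ^+ p * ((1 - beta) ^+ p * N%:R + p%:R * err m).
Proof.
have [b0 b1] := andP beta_bounds.
have e0 : 0 <= err m.
  rewrite /err !mulr_ge0 ?ler0n ?invr_ge0 ?(ltW Kgt0) // exprn_ge0 //.
  by rewrite addr_ge0 // divr_ge0 // ?ler0n // ltW.
elim: p => [_|p IH pm].
  rewrite (bigD1 [tuple]) //= big1 => [|s /eqP[]]; last exact: tuple0.
  rewrite /damped /gram big_nil scaler0 subr0 expr1n !expr0 mul0r !addr0 !mul1r.
  by rewrite mxtrace1.
(* Averaging over the newest draw, the others being fixed, gains the factor 1 - beta. *)
rewrite sum_tupleS exchange_big /=.
have le1 s : size s = p -> \sum_i \tr (damped (i :: s) ^+ K) <=
    M%:R * ((1 - beta) * \tr (damped s ^+ K) + err m).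
  move=> sp; rewrite mulrDr mulrA -sum_tr_damped_mul.
  have -> : M%:R * err m = \sum_(i < M) err m.
    by rewrite sumr_const card_ord mulr_natl.
  rewrite -big_split /=; apply: ler_sum => i _.
  have := @tr_damped_cons_le i s m; rewrite sp => /(_ pm).
  by rewrite (ger0_norm (tr_damped_ge0 _)) (ger0_norm (tr_damped_mul_ge0 _ _)).
apply: (@le_trans _ _ (\sum_(s : p.-tuple 'I_M)
    M%:R * ((1 - beta) * \tr (damped s ^+ K) + err m))).
  by apply: ler_sum => s _; apply: le1; rewrite size_tuple.
rewrite -mulr_sumr big_split /= -mulr_sumr sumr_const card_tuple card_ord.
rewrite exprS -mulrA ler_wpM2l ?ler0n //.
have le2 := ler_wpM2l b0 (IH (ltnW pm)).
apply: le_trans (lerD le2 (lexx _)) _.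
rewrite -[err m *+ _]mulr_natl natrX exprS.
set B := M%:R ^+ p.
have -> : (1 - beta) * (B * ((1 - beta) ^+ p * N%:R + p%:R * err m)) + B * err m =
  B * ((1 - beta) * (1 - beta) ^+ p * N%:R + ((1 - beta) * (p%:R * err m) + err m)).
  by ring.
rewrite ler_wpM2l ?exprn_ge0 ?ler0n // lerD2l.
have -> : p.+1%:R * err m = p%:R * err m + err m.
  by rewrite -[p.+1]addn1 natrD mulrDl mul1r.
by rewrite lerD2r ler_piMl // mulr_ge0 ?ler0n.
Qed.

(** One direction with a small quadratic form already makes the trace large: [quad_pow2_le] moves
    the power inside the form, and the form of a positive matrix at a unit vector is at most its
    trace. The bound on x keeps 1 - a x nonnegative, so that taking powers is monotone. *)
Lemma tr_damped_ge s (w : 'cV[C]_N) (x : C) :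
  \tr (w^! *m w) = 1 -> \tr (w^! *m gram s *m w) <= x -> x <= N%:R * Kr ->
  (1 - a * x) ^+ K <= \tr (damped s ^+ K).
Proof.
move=> w1 wx xNK.
have q1 : 0 <= 1 - a * x.
  by rewrite subr_ge0 /a mulrC ler_pdivrMr ?mul1r // mulr_gt0.
have q2 : 1 - a * x <= \tr (w^! *m damped s *m w).
  rewrite /damped mulmxBr mulmx1 mulmxBl raddfB /= w1 lerD2l lerN2.
  by rewrite -scalemxAr -scalemxAl linearZ /= ler_wpM2l.
have q3 := quad_pow2_le k (damped_adj s) w1.
apply: (@le_trans _ _ (`|\tr (w^! *m damped s *m w)| ^+ K)).
  rewrite ler_pXn2r ?nnegrE // ?expn_gt0 //.
  by rewrite ger0_norm // (le_trans q1).
apply: le_trans q3 _; rewrite -/K.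
set P := damped s ^+ (2 ^ k.-1).
have hP : P^! = P by rewrite adjmxX damped_adj.
have -> : \tr (w^! *m damped s ^+ K *m w) = \tr ((P *m w) *m (P *m w)^!).
  by rewrite even_pow -/P -mulmxE adjmxM hP [RHS]mxtrace_mulC !mulmxA.
have := fro_mul_le P w; rewrite [\tr (w *m _)]mxtrace_mulC w1 mulr1 hP.
by rewrite ger0_norm ?fro_ge0 // mulmxE -even_pow.
Qed.

End scale.
End random_gram.


Section complex_facts.
Variable R : realType.
Implicit Types z : R[i].

Lemma normcE_real z : `|z| = (normc z)%:C%C. Proof. by []. Qed.

Lemma conjcE z : z^* = (z^*)%C.
Proof. by []. Qed.

Lemma normc_ge0 z : 0 <= normc z.
Proof. by case: z => a b; apply: sqrtr_ge0. Qed.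

Lemma normc_sq z : normc z ^+ 2 = complex.Re z ^+ 2 + complex.Im z ^+ 2.
Proof. by case: z => a b /=; rewrite sqr_sqrtr // addr_ge0 ?sqr_ge0. Qed.

End complex_facts.

(** * From small traces to coercivity, and the number of bad samples *)

Section good_samples.
Variables (R : realType) (N M : nat) (v : 'I_M -> 'cV[R[i]]_N).
Hypothesis N0 : (0 < N)%N.
Hypothesis vnorm : forall i j, `|v i j 0| = 1.

Definition damped_trace k (s : seq 'I_M) : R :=
  complex.Re (\tr (damped v k s ^+ (2 ^ k))).

Lemma quad_gram (s : seq 'I_M) (w : 'cV[R[i]]_N) :
  \tr ((adjmx w) *m gram v s *m w)
    = (\sum_(i <- s) normc (\sum_j (v i j 0)^* * w j 0) ^+ 2)%:C%C.
Proof.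
rewrite /gram mulmx_sumr mulmx_suml raddf_sum rmorph_sum.
apply: eq_bigr => i _ /=.
have -> : adjmx w *m outer v i *m w
    = adjmx (adjmx (v i) *m w) *m (adjmx (v i) *m w).
  by rewrite adjmxM adjmxK /outer !mulmxA.
rewrite rmorphXn /= -normcE_real /mxtrace big_ord1 mxE big_ord1 !mxE mulrC -normCK.
by congr (`|_| ^+ 2); apply: eq_bigr => j _; rewrite !mxE.
Qed.

(** By contraposition: a vector c violating the bound, once normalized, has quadratic form at most
    [size s] / 4, and [tr_damped_ge] makes the trace at least the excluded value. *)
Lemma small_trace_coercive k (s : seq 'I_M) (c : 'I_N -> R[i]) :
  (0 < k)%N -> ((size s)%:R <= N%:R * (2 ^ k)%:R :> R) ->
  damped_trace k s < (1 - (size s)%:R / (4 * (N%:R * (2 ^ k)%:R))) ^+ (2 ^ k) ->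
  (size s)%:R / 4 * (\sum_j normc (c j) ^+ 2) <=
    \sum_(i <- s) normc (\sum_j (v i j 0)^* * c j) ^+ 2.
Proof.
move=> k0 sNK small; rewrite leNgt; apply/negP => lt.
set n2 := \sum_j normc (c j) ^+ 2 in lt.
have n20 : 0 <= n2 by apply: sumr_ge0 => j _; rewrite sqr_ge0.
have n2gt : 0 < n2.
  rewrite lt_def n20 andbT; apply/eqP => n2E; move: lt; rewrite n2E mulr0 ltNge.
  by rewrite sumr_ge0 // => i _; rewrite sqr_ge0.
pose b := (Num.sqrt n2)^-1.
have b2 : b ^+ 2 = n2^-1 by rewrite exprVn sqr_sqrtr.
pose w : 'cV[R[i]]_N := \col_j (b%:C%C * c j).
have nb z : normc (b%:C%C * z) ^+ 2 = n2^-1 * normc z ^+ 2.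
  rewrite normcM exprMn; congr (_ * _).
  by rewrite normc_sq /= expr0n addr0 b2.
have w1 : \tr (adjmx w *m w) = 1.
  rewrite mxtrace_mulC fro_sum.
  under eq_bigr do rewrite big_ord1 !mxE normcE_real -rmorphXn /= nb.
  by rewrite -rmorph_sum /= -mulr_sumr mulVf ?lt0r_neq0.
have wg : \tr (adjmx w *m gram v s *m w) <= ((size s)%:R / 4 : R)%:C%C.
  rewrite quad_gram lecR.
  under eq_bigr => i _.
    rewrite [X in normc X](_ : _ = b%:C%C * \sum_j (v i j 0)^* * c j); last first.
      by rewrite mulr_sumr; apply: eq_bigr => j _; rewrite mxE mulrCA.
    rewrite nb; over.
  by rewrite -mulr_sumr mulrC ler_pdivrMr // ltW.
have := tr_damped_ge N0 k0 w1 wg.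
have NKgt : 0 < N%:R * (2 ^ k)%:R :> R by rewrite mulr_gt0 ?ltr0n ?expn_gt0.
have -> : N%:R * (2 ^ k)%:R = (N%:R * (2 ^ k)%:R : R)%:C%C :> R[i].
  by rewrite rmorphM /= !rmorph_nat.
set q := N%:R * (2 ^ k)%:R in NKgt *; set x := (size s)%:R / 4.
have toC (y z : R) n : (1 - (y%:C%C)^-1 * z%:C%C) ^+ n
    = ((1 - y^-1 * z) ^+ n)%:C%C :> R[i].
  by rewrite rmorphXn rmorphB rmorph1 rmorphM fmorphV.
rewrite toC.
rewrite lecR.
have le4 : x <= q.
  by apply: le_trans sNK; rewrite ler_pdivrMr // ler_peMr ?ler0n // ler1n.
move=> /(_ le4); rewrite lecE => /andP[_]; rewrite -/(damped_trace _ _) /=.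
rewrite leNgt => /negP; apply.
have toE (y z : R) : y^-1 * (z / 4) = z / (4 * y).
  by rewrite invfM [RHS]mulrA mulrC.
by rewrite toE.
Qed.

End good_samples.

Section counting.
Variable R : realType.

Lemma sum_Re (I : Type) (s : seq I) (F : I -> R[i]) :
  complex.Re (\sum_(i <- s) F i) = \sum_(i <- s) complex.Re (F i).
Proof.
elim: s => [|i s IH]; rewrite ?big_nil ?big_cons // -IH.
by case: (F i) (\sum_(_ <- _) _) => [? ?] [? ?].
Qed.

Lemma pow_half (K : nat) : (0 < K)%N -> (1 - K%:R^-1) ^+ K <= 2^-1 :> R.
Proof.
move=> K0; have KR : 0 < K%:R :> R by rewrite ltr0n.
have h : 1 - K%:R^-1 <= expR (- K%:R^-1) :> R by exact: expR_ge1Dx.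
have h0 : 0 <= 1 - K%:R^-1 :> R by rewrite subr_ge0 invf_le1 // ler1n.
apply: (@le_trans _ _ (expR (- K%:R^-1) ^+ K)).
  by rewrite ler_pXn2r // nnegrE expR_ge0.
rewrite -expRM_natl mulrN mulfV ?lt0r_neq0 // expRN lef_pV2 ?posrE ?expR_gt0 //.
by have := expR_ge1Dx (1 : R).
Qed.

(** For 0 <= y <= 1/5 one has (1 - y) (1 + 5/4 y) >= 1, hence 1 - y >= exp (- 5/4 y); take y = x /
    K. *)
Lemma pow_ge_expR (x : R) (K : nat) : (0 < K)%N -> 0 <= x ->
  5 * x <= K%:R -> expR (- (5 / 4 * x)) <= (1 - x / K%:R) ^+ K.
Proof.
move=> K0 x0 xK; have KR : 0 < K%:R :> R by rewrite ltr0n.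
set y := x / K%:R.
have y0 : 0 <= y by rewrite divr_ge0 // ltW.
have y5 : 5 * y <= 1 by rewrite mulrA ler_pdivrMr // mul1r.
have h : expR (- (5 / 4 * y)) <= 1 - y.
  rewrite expRN -[1 - y]invrK lef_pV2 ?posrE ?invr_gt0 ?expR_gt0 //; last by lra.
  apply: le_trans (expR_ge1Dx _).
  rewrite -[_^-1]mul1r ler_pdivrMr; last by lra.
  nra.
have -> : - (5 / 4 * x) = K%:R * (- (5 / 4 * y)).
  by rewrite /y; field; rewrite lt0r_neq0.
by rewrite expRM_natl ler_pXn2r ?nnegrE ?expR_ge0 //; lra.
Qed.

Lemma pow_le_expR (x : R) (n : nat) : 0 <= 1 + x -> (1 + x) ^+ n <= expR (n%:R * x).
Proof.
by move=> x0; rewrite expRM_natl lerXn2r ?nnegrE ?expR_ge0 // expR_ge1Dx.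
Qed.

(** The rate beta is at least 1 / (2 N), because (1 - 1/K)^K <= 1/2. The second summand bounds the
    accumulated [err m], as (1 + m/K)^(2 K) <= exp (2 m). *)
Lemma sum_damped_trace_le (N M : nat) (v : 'I_M -> 'cV[R[i]]_N) (k m : nat) :
  (0 < N)%N -> (0 < k)%N ->
  (forall i j, `|v i j 0| = 1) -> \sum_i outer v i = M%:R%:M ->
  \sum_(s : m.-tuple 'I_M) damped_trace v k s <=
  M%:R ^+ m * (expR (- (m%:R / (2 * N%:R))) * N%:R
               + m%:R * (N%:R * m%:R * expR (2 * m%:R)) / (2 ^ k)%:R).
Proof.
move=> N0 k0 vn tight.
have NR : 0 < N%:R :> R by rewrite ltr0n.
have KR : 0 < (2 ^ k)%:R :> R by rewrite ltr0n expn_gt0.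
have K1 : (0 < 2 ^ k)%N by rewrite expn_gt0.
have := sum_tr_damped_le N0 vn k0 tight (leqnn m).
set K := (2 ^ k)%N in KR K1 *.
pose be : R := (1 - (1 - K%:R^-1) ^+ K) / N%:R.
pose er : R := N%:R * (m%:R * (1 + m%:R / K%:R) ^+ (2 * K) / K%:R).
have nC n : n%:R = (n%:R : R)%:C%C :> R[i] by rewrite rmorph_nat.
have oneC : 1 = (1 : R)%:C%C :> R[i] by [].
have beC : (1 - (1 - (K%:R : R[i])^-1) ^+ K) / N%:R = be%:C%C.
  by rewrite !nC -!fmorphV oneC -rmorphB -rmorphXn -rmorphB -rmorphM.
have erC : N%:R * (m%:R * (1 + m%:R / K%:R) ^+ (2 * K) / K%:R) = er%:C%C :> R[i].
  by rewrite !nC -!fmorphV oneC -!rmorphM -rmorphD -rmorphXn -!rmorphM.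
have toC : M%:R ^+ m * ((1 - be%:C%C) ^+ m * N%:R + m%:R * er%:C%C)
         = (M%:R ^+ m * ((1 - be) ^+ m * N%:R + m%:R * er))%:C%C.
  by rewrite !nC oneC -rmorphB -!rmorphXn -!rmorphM -rmorphD -rmorphM.
rewrite beC erC toC lecE => /andP[_] /=; rewrite sum_Re => /le_trans; apply.
rewrite ler_wpM2l ?exprn_ge0 ?ler0n // lerD //.
  rewrite ler_wpM2r ?ler0n //.
  have hb : (2 * N%:R)^-1 <= be.
    rewrite /be invfM ler_wpM2r ?invr_ge0 ?ler0n //.
    by have := pow_half K1; lra.
  have hb1 : be <= 1.
    rewrite /be ler_pdivrMr // mul1r.
    apply: (@le_trans _ _ 1); last by rewrite ler1n.
    rewrite gerBl exprn_ge0 // subr_ge0 invf_le1 // ler1n //.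
  apply: (@le_trans _ _ (expR (m%:R * (- be)))).
    by apply: pow_le_expR; rewrite subr_ge0.
  by rewrite ler_expR mulrN lerN2 ler_wpM2l ?ler0n.
rewrite -mulrA ler_wpM2l ?ler0n // /er.
rewrite -!mulrA ler_wpM2l ?ler0n // ler_wpM2l ?ler0n // ler_wpM2r ?invr_ge0 ?ler0n //.
have -> : 2 * m%:R = (2 * K)%N%:R * (m%:R / K%:R) :> R.
  by rewrite natrM; field; rewrite lt0r_neq0.
by apply: pow_le_expR; rewrite addr_ge0 // divr_ge0 ?ler0n.
Qed.

(* The scale 2 ^ k only has to absorb the error of the finite powers. *)
Lemma card_large_trace_le (N m : nat) (e : R) :
  (0 < N)%N -> 0 < e ->
  N%:R * expR (- (3 / 16 * (m%:R / N%:R))) <= e / 2 ->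
  exists k, [/\ (0 < k)%N, m%:R <= N%:R * (2 ^ k)%:R :> R &
    forall (M : nat) (v : 'I_M -> 'cV[R[i]]_N),
      (forall i j, `|v i j 0| = 1) -> \sum_i outer v i = M%:R%:M ->
      (#|[set s : m.-tuple 'I_M |
         ((1 - m%:R / (4 * (N%:R * (2 ^ k)%:R))) ^+ (2 ^ k) <= damped_trace v k s)%R]%SET|)%:R
      <= 3 / 4 * e * M%:R ^+ m].
Proof.
move=> N0 e0 Ne; have NR : 0 < N%:R :> R by rewrite ltr0n.
(* The error of the finite powers relative to exp (- 5/16 m / N), the lower bound for the trace of a
   bad sample; k is taken so large that D / 2^k <= e / 4. *)
pose D : R := m%:R * (N%:R * m%:R * expR (2 * m%:R)) * expR (5 / 16 * (m%:R / N%:R)).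
have D0 : 0 <= D.
  by rewrite /D; do ?apply: mulr_ge0; rewrite ?expR_ge0 ?ler0n.
pose k := (Num.bound (4 * D / e) + 2 * m).+1.
have kK : (k%:R : R) <= (2 ^ k)%:R by rewrite ler_nat ltnW // ltn_expl.
have mK : 2 * m%:R <= (2 ^ k)%:R :> R.
  by apply: le_trans kK; rewrite -natrM ler_nat leqW ?leq_addl.
have DK : 4 * D / e <= (2 ^ k)%:R.
  apply: le_trans kK.
  apply: le_trans (ltW (archi_boundP _)) _; first by rewrite divr_ge0 ?(ltW e0) // mulr_ge0.
  by rewrite ler_nat leqW ?leq_addr.
exists k; split=> // [|M v vn tight].
  apply: (@le_trans _ _ (2 * m%:R)); first by rewrite ler_peMl ?ler0n // ler1n.
  by apply: le_trans mK _; rewrite ler_peMl ?ler0n // ler1n.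
set tau := (1 - _) ^+ (2 ^ k); set S := [set s | _]%SET.
have K0 : (0 < 2 ^ k)%N by rewrite expn_gt0.
have KR : 0 < (2 ^ k)%:R :> R by rewrite ltr0n.
have tauE : expR (- (5 / 16 * (m%:R / N%:R))) <= tau.
  have := @pow_ge_expR (m%:R / (4 * N%:R)) _ K0.
  rewrite divr_ge0 ?mulr_ge0 ?ler0n // => /(_ isT) H.
  have -> : tau = (1 - m%:R / (4 * N%:R) / (2 ^ k)%:R) ^+ (2 ^ k).
    by rewrite /tau; congr ((1 - _) ^+ _); field; rewrite !lt0r_neq0.
  have -> : 5 / 16 * (m%:R / N%:R) = 5 / 4 * (m%:R / (4 * N%:R)) :> R.
    by field; rewrite !lt0r_neq0.
  apply: H; rewrite mulrA ler_pdivrMr ?mulr_gt0 //.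
  apply: (@le_trans _ _ ((2 * m%:R) * 4)).
    by rewrite mulrAC ler_wpM2r ?ler0n // -natrM ler_nat.
  apply: ler_pM; rewrite ?mulr_ge0 ?ler0n //.
  by rewrite ler_peMr // ler1n.
have tau0 : 0 < tau by apply: lt_le_trans tauE; rewrite expR_gt0.
(* Markov's inequality, the remaining traces being nonnegative. *)
have S1 : #|S|%:R * tau <= \sum_(s : m.-tuple 'I_M) damped_trace v k s.
  rewrite (bigID (mem S)) /= mulr_natl -sumr_const.
  rewrite -[X in X <= _]addr0 lerD //.
    by apply: ler_sum => s; rewrite inE.
  apply: sumr_ge0 => s _.
  have := @tr_damped_ge0 _ _ _ v k (ltn0Sn _) s.
  by rewrite lecE => /andP[].
have S2 := le_trans S1 (sum_damped_trace_le m N0 (ltn0Sn _) vn tight).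
rewrite -(ler_pM2r tau0); apply: le_trans S2 _.
have -> : 3 / 4 * e * M%:R ^+ m * tau = M%:R ^+ m * (3 / 4 * e * tau) by ring.
rewrite ler_wpM2l ?exprn_ge0 ?ler0n //.
set t := 5 / 16 * (m%:R / N%:R) in tauE.
apply: (@le_trans _ _ (3 / 4 * e * expR (- t))); last first.
  by rewrite ler_wpM2l // mulr_ge0 // ltW.
(* The decay rate 1/2 of the mean trace less the 5/16 of the threshold [tau] leaves the 3/16 of the
   hypothesis. *)
have -> : - (m%:R / (2 * N%:R)) = - (3 / 16 * (m%:R / N%:R)) + - t :> R.
  by rewrite /t; field; rewrite lt0r_neq0.
have DE : m%:R * (N%:R * m%:R * expR (2 * m%:R)) = D * expR (- t).
  by rewrite /D -[RHS]mulrA -expRD subrr expR0 mulr1.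
rewrite DE expRD mulrAC [X in _ + X]mulrAC -mulrDl ler_wpM2r ?expR_ge0 //.
have DK' : D / (2 ^ k)%:R <= e / 4.
  move: DK; rewrite !ler_pdivrMr // mulrAC ler_pdivlMr //.
  by rewrite (mulrC D) (mulrC e).
have -> : 3 / 4 * e = e / 2 + e / 4 by field.
by rewrite lerD // mulrC.
Qed.

End counting.


(** * Least squares on lattice points *)

Section characters.
Variables (R : realType) (m : nat).
Implicit Types (k l : m.-tuple int) (x : m.-tuple R).

Lemma normc_expchar k x : normc (expchar k x) = 1.
Proof. by rewrite /expchar /= cos2Dsin2 sqrtr1. Qed.

Lemma expchar_sub k l x :
  expchar [tuple tnth k j - tnth l j | j < m] x = expchar k x * (expchar l x)^*.
Proof.
rewrite /expchar /=.
have -> : \sum_(j < m) (tnth [tuple tnth k j - tnth l j | j < m] j)%:~R * tnth x j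
  = \sum_(j < m) (tnth k j)%:~R * tnth x j - \sum_(j < m) (tnth l j)%:~R * tnth x j :> R.
  by rewrite -sumrB; apply: eq_bigr => j _; rewrite tnth_mktuple intrD mulrDl rmorphN mulNr.
rewrite mulrBr; set a := 2 * pi * _; set b := 2 * pi * _.
rewrite conjcE /=; apply/eqP; rewrite eq_complex /= cosB sinB.
by apply/andP; split; apply/eqP; ring.
Qed.

End characters.

Section least_squares_bound.
Variables (R : realType) (m : nat) (J : {fset m.-tuple int}).
Implicit Types (c h : m.-tuple int -> R[i]) (x : m.-tuple R).

Lemma trig_poly_comb (a b : R[i]) c h x :
  trig_poly J (fun k => a * c k + b * h k) x
    = a * trig_poly J c x + b * trig_poly J h x.
Proof.
rewrite /trig_poly !mulr_sumr -big_split /=; apply: eq_bigr => k _.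
by rewrite mulrDl !mulrA.
Qed.

Lemma normc_affine (t : R) (a b : R[i]) :
  normc ((1 - t)%:C%C * a + t%:C%C * b) ^+ 2 =
  (1 - t) * normc a ^+ 2 + t * normc b ^+ 2 - t * (1 - t) * normc (a - b) ^+ 2.
Proof. by case: a b => [a1 a2] [b1 b2]; rewrite !normc_sq /=; ring. Qed.

(* Comparing the minimizer [c] with the points of the segment from [c] to [h]:
   the projection onto the trigonometric polynomials is a contraction. *)
Lemma least_squares_contraction (X : seq (m.-tuple R)) g c h :
  least_squares J X g c ->
  \sum_(x <- X) normc (trig_poly J (fun k => c k - h k) x) ^+ 2 <=
  \sum_(x <- X) normc (trig_poly J h x - g x) ^+ 2.
Proof.
move=> ls.
set Q := (X in X <= _); set E := (X in _ <= X).
have Q0 : 0 <= Q by apply: sumr_ge0 => x _; rewrite sqr_ge0.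
have key t : 0 < t -> (1 - t) * Q <= E.
  move=> t0.
  have := ls (fun k => (1 - t)%:C%C * c k + t%:C%C * h k).
  set S := (X in X <= _) => le1.
  have S0 : 0 <= S by apply: sumr_ge0 => x _; rewrite sqr_ge0.
  have : S <= (1 - t) * S + t * E - t * (1 - t) * Q.
    apply: le_trans le1 _; rewrite le_eqVlt; apply/orP; left; apply/eqP.
    rewrite /S /E /Q !mulr_sumr -big_split -sumrB /=; apply: eq_bigr => x _.
    rewrite -mulrA.
    have -> : trig_poly J (fun k => c k - h k) x
            = (trig_poly J c x - g x) - (trig_poly J h x - g x).
      have := trig_poly_comb 1 (-1) c h x; rewrite mul1r mulN1r => E1.
      rewrite opprB addrA subrK -E1 /trig_poly.
      by apply: eq_bigr => k _; rewrite mul1r mulN1r.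
    rewrite mulrA -normc_affine; congr (normc _ ^+ 2).
    rewrite trig_poly_comb rmorphB rmorph1; ring.
  have -> : (1 - t) * S + t * E - t * (1 - t) * Q = S + t * (E - S - (1 - t) * Q).
    by ring.
  rewrite -[X in X <= _]addr0 lerD2l pmulr_rge0 // => h1.
  by rewrite -subr_ge0; apply: le_trans h1 _; rewrite lerD2r gerBl.
rewrite leNgt; apply/negP => EQ.
have QE : 0 < Q - E by rewrite subr_gt0.
have Qp : 0 < Q by apply: le_lt_trans EQ; apply: sumr_ge0 => x _; rewrite sqr_ge0.
(* For this t the left side (1 - t) Q of [key] is (Q + E) / 2, which exceeds E. *)
have := key ((Q - E) / (2 * Q)); rewrite divr_gt0 ?mulr_gt0 // => /(_ isT).
rewrite mulrBl mul1r.
have -> : (Q - E) / (2 * Q) * Q = (Q - E) / 2 by field; rewrite lt0r_neq0.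
by move: QE; clearbody Q E; lra.
Qed.

(** The contraction bounds the mean square of the polynomial with coefficients c - h by E^2;
    coercivity with constant 1/4 turns this into |c - h|^2 <= 4 E^2, whence the factor 2. *)
Lemma least_squares_coef (X : seq (m.-tuple R)) g c h (E : R) k :
  (forall c', (size X)%:R / 4 * (\sum_(l <- J) normc (c' l) ^+ 2) <=
              \sum_(x <- X) normc (trig_poly J c' x) ^+ 2) ->
  (0 < size X)%N -> 0 <= E ->
  least_squares J X g c ->
  (forall x, normc (trig_poly J h x - g x) <= E) -> k \in J ->
  normc (c k - h k) <= 2 * E.
Proof.
move=> coer X0 E0 ls hE kJ.
have le1 := le_trans (coer (fun k => c k - h k)) (least_squares_contraction h ls).
have le2 : \sum_(x <- X) normc (trig_poly J h x - g x) ^+ 2 <= (size X)%:R * E ^+ 2.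
  apply: (@le_trans _ _ (\sum_(x <- X) E ^+ 2)).
    by apply: ler_sum => x _; rewrite ler_pXn2r ?nnegrE ?normc_ge0.
  by rewrite big_const_seq count_predT iter_addr_0 mulr_natl.
have {}le1 := le_trans le1 le2.
have XR : 0 < (size X)%:R :> R by rewrite ltr0n.
have le3 : normc (c k - h k) ^+ 2 <= \sum_(l <- J) normc (c l - h l) ^+ 2.
  rewrite big_seq_fsetE /= (bigD1 [` kJ]%fset) //= lerDl.
  by apply: sumr_ge0 => l _; rewrite sqr_ge0.
rewrite -(@ler_pXn2r _ 2) ?nnegrE ?normc_ge0 ?mulr_ge0 //.
apply: le_trans le3 _; move: le1; rewrite -mulrA ler_pM2l // mulrC ler_pdivrMr //.
by move/le_trans; apply; rewrite le_eqVlt; apply/orP; left; apply/eqP; ring.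
Qed.

End least_squares_bound.

Section lattice_vectors.
Variables (R : realType) (m : nat) (J : {fset m.-tuple int}) (M : nat).
Variable z : m.-tuple R.

(* Conjugated, so that [adjmx (lattice_vec i) *m c] is the value at the i-th
   lattice point of the trigonometric polynomial with coefficients c. *)
Definition lattice_vec (i : 'I_M) : 'cV[R[i]]_(size J) :=
  \col_j (expchar (tnth (in_tuple J) j) (lattice_pt M z i))^*.

Lemma lattice_vec_norm i j : `|lattice_vec i j 0| = 1.
Proof. by rewrite mxE norm_conjC normcE_real normc_expchar. Qed.

Lemma sum_outer_lattice_vec : (0 < M)%N -> reconstructing J M z ->
  \sum_i outer lattice_vec i = M%:R%:M.
Proof.
move=> M0 rec; apply/matrixP => a b; rewrite summxE !mxE.
have aJ : tnth (in_tuple J) a \in J by apply: mem_tnth.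
have bJ : tnth (in_tuple J) b \in J by apply: mem_tnth.
under eq_bigr do rewrite outerE !mxE conjCK mulrC.
have := rec _ _ bJ aJ => /=.
under eq_bigr do rewrite expchar_sub.
set S := \sum_(i < M) _.
have M1 : (M%:R : R[i]) != 0 by rewrite pnatr_eq0 -lt0n.
rewrite fmorphV rmorph_nat => /(congr1 ( *%R M%:R)); rewrite mulrA mulfV // mul1r => ->.
rewrite mulr_natr; congr (_ *+ nat_of_bool _).
apply/eqP/eqP => [E|->]; last by apply: eq_from_tnth => j; rewrite !tnth_mktuple subrr.
have /tuple_uniqP inj : uniq (in_tuple J) by exact: fset_uniq.
apply: inj; apply: eq_from_tnth => j; apply/eqP; rewrite eq_sym -subr_eq0.
by move: (congr1 (fun t => tnth t j) E); rewrite !tnth_mktuple => ->.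
Qed.

Lemma trig_poly_lattice c (i : 'I_M) :
  trig_poly J c (lattice_pt M z i) =
  \sum_j (lattice_vec i j 0)^* * c (tnth (in_tuple J) j).
Proof.
rewrite /trig_poly big_tnth; apply: eq_bigr => j _.
by rewrite mxE conjCK mulrC.
Qed.

Lemma lattice_coercive k (s : seq 'I_M) :
  (0 < size J)%N -> (0 < k)%N -> ((size s)%:R <= (size J)%:R * (2 ^ k)%:R :> R) ->
  damped_trace lattice_vec k s
    < (1 - (size s)%:R / (4 * ((size J)%:R * (2 ^ k)%:R))) ^+ (2 ^ k) ->
  forall c, (size s)%:R / 4 * (\sum_(l <- J) normc (c l) ^+ 2) <=
    \sum_(x <- [seq lattice_pt M z (nat_of_ord i) | i <- s]) normc (trig_poly J c x) ^+ 2.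
Proof.
move=> J0 k0 sk small c.
have := small_trace_coercive (v := lattice_vec) J0
  (fun j => c (tnth (in_tuple J) j)) k0 sk small.
rewrite big_map (big_tnth _ _ (enum_fset J)) => /le_trans; apply.
by rewrite le_eqVlt; apply/orP; left; apply/eqP; apply: eq_bigr => i _;
   rewrite trig_poly_lattice.
Qed.

End lattice_vectors.


(** * Trigonometric polynomials under the Haar measure *)

Section haar_integrals.
Variable R : realType.

Definition phase m (k : m.-tuple int) (x : m.-tuple R) : R :=
  2 * pi * \sum_(j < m) (tnth k j)%:~R * tnth x j.

Lemma measurable_phase m (k : m.-tuple int) : measurable_fun setT (phase k).
Proof.
apply: measurable_funM => //; apply: measurable_sum => j.
by apply: measurable_funM => //; exact: measurable_tnth.
Qed.

Lemma measurable_cos : measurable_fun setT (@cos R).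
Proof. by apply: continuous_measurable_fun; exact: continuous_cos. Qed.

Lemma measurable_sin : measurable_fun setT (@sin R).
Proof. by apply: continuous_measurable_fun; exact: continuous_sin. Qed.

Lemma phase_cons m (k : m.+1.-tuple int) (x : R) (y : m.-tuple R) :
  phase k (cons_pt (x, y)) =
  2 * pi * (thead k)%:~R * x + phase [tuple of behead k] y.
Proof.
rewrite /phase big_ord_recl /= mulrDr mulrA; congr (_ + 2 * pi * _).
by apply: eq_bigr => j _; rewrite tnth_behead !(tnth_nth 0) /= inordK // ltnS.
Qed.

Lemma sin_int_period (n : int) (b : R) : sin (2 * pi * n%:~R + b) = sin b.
Proof.
have E (p : nat) : 2 * pi * p%:R = (pi *+ 2) *+ p :> R.
  by rewrite mulr_natr mulr_natl.
case: n => p; first by rewrite E addrC (periodicn (@sinD2pi R)).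
rewrite NegzE rmorphN mulrN /= E.
by rewrite -[in RHS](subrK ((pi *+ 2) *+ p.+1) b) (periodicn (@sinD2pi R)) addrC.
Qed.

Lemma integral_uniform_cos (n : int) (b : R) : n != 0 ->
  (\int[uniform_prob (@ltr01 R)]_x (1 + cos (2 * pi * n%:~R * x + b))%:E = 1)%E.
Proof.
move=> n0; set w : R := 2 * pi * n%:~R.
have w0 : w != 0 by rewrite !mulf_neq0 ?intr_eq0 // lt0r_neq0 ?pi_gt0.
have cw : continuous (fun x : R => w * x + b).
  move=> x; apply: cvgD; last exact: cvg_cst.
  by apply: cvgM; [exact: cvg_cst|exact: cvg_id].
have cc : continuous (fun x : R => 1 + cos (w * x + b)).
  move=> x; apply: cvgD; first exact: cvg_cst.
  by apply: continuous_comp; [exact: cw|exact: continuous_cos].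
rewrite integral_uniform; last 2 first.
- by apply/measurable_EFinP; exact: continuous_measurable_fun.
- by move=> x; rewrite lee_fin -lerBlDl sub0r cos_geN1.
pose F (x : R) := x + w^-1 * sin (w * x + b).
have dF (x : R) : is_derive x 1 F (1 + cos (w * x + b)).
  rewrite /F; apply: is_derive_eq.
  by rewrite /GRing.scale /=; field.
have dF' (x : R) : derivable F x 1 by case: (dF x).
have cF : continuous F.
  by move=> x; apply/differentiable_continuous/derivable1_diffP.
rewrite (@continuous_FTC2 _ (fun x => 1 + cos (w * x + b)) F) //; last 3 first.
- exact: continuous_subspaceT.
- split=> [x _||]; first exact: dF'.
    by apply: cvg_at_right_filter; exact: cF.
  by apply: cvg_at_left_filter; exact: cF.
- by move=> x _; rewrite derive1E; case: (dF x).
rewrite subr0 invr1 mul1e -EFinB /F mulr1 mulr0 !add0r sin_int_period.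
by congr (_%:E); ring.
Qed.

(** Adding 1 makes the integrand nonnegative, so Tonelli's theorem applies directly. The phase b
    absorbs the coordinates that are held fixed in the induction. *)
Lemma integral_haar_cos_ge0 m (k : m.-tuple int) (b : R) :
  (\int[haar R m]_x (1 + cos (phase k x + b))%:E =
   (if k == [tuple 0 | j < m] then 1 + cos b else 1)%:E)%E.
Proof.
have mf p (l : p.-tuple int) (c : R) :
    measurable_fun setT (fun x => (1 + cos (phase l x + c))%:E).
  apply/measurable_EFinP; apply: measurable_funD => //.
  apply: measurableT_comp; first exact: measurable_cos.
  by apply: measurable_funD => //; exact: measurable_phase.
have f0 (x : R) : (0 <= (1 + cos x)%:E)%E by rewrite lee_fin -lerBlDl sub0r cos_geN1.
elim: m k b => [|m IH] k b.
  rewrite /= integral_dirac //; last exact: mf.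
  rewrite ?diracT ?mul1e /phase big_ord0 mulr0 add0r.
  by rewrite [k]tuple0 [X in _ == X]tuple0 eqxx.
rewrite /= ge0_integral_distribution //; last exact: mf.
have mg : measurable_fun setT
    ((fun x : m.+1.-tuple R => (1 + cos (phase k x + b))%:E) \o @cons_pt R m).
  by exact: (measurableT_comp (mf _ _ _) (@measurable_cons_pt R m)).
have k0E : (k == [tuple 0 | j < m.+1]) =
    (thead k == 0) && ([tuple of behead k] == [tuple 0 | j < m]).
  apply/eqP/andP => [->|[/eqP k0 /eqP k1]].
    split; first by rewrite /thead tnth_mktuple.
    by apply/eqP/eq_from_tnth => j; rewrite tnth_behead !tnth_mktuple.
  apply: eq_from_tnth => j; rewrite tnth_mktuple.
  case: (unliftP ord0 j) => [i ->|-> //].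
  have := congr1 (fun t => tnth t i) k1; rewrite tnth_behead tnth_mktuple => <-.
  by congr tnth; apply: val_inj; rewrite /= inordK // ltnS.
rewrite k0E; case: eqP => [k0|/eqP k0] /=.
  rewrite fubini_tonelli1 //=.
  under eq_integral => x _.
    rewrite /fubini_F /=.
    under eq_integral do rewrite phase_cons k0 mulr0 mul0r add0r.
    rewrite IH; over.
  by rewrite integral_cst // [X in (_ * X)%E]probability_setT mule1.
(* When the first frequency is nonzero, integrating its coordinate first already removes the
   cosine. *)
rewrite fubini_tonelli2 //=.
under eq_integral => y _.
  rewrite /fubini_G /=.
  under eq_integral do rewrite phase_cons -addrA.
  rewrite integral_uniform_cos //; over.
by rewrite integral_cst // [X in (_ * X)%E]probability_setT mule1.
Qed.

End haar_integrals.

Section second_moment.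
Variables (R : realType) (m : nat).
Local Notation mu := (haar R m).

Lemma integrable_bounded (g : m.-tuple R -> R) (B : R) :
  measurable_fun setT g -> (forall x, `|g x| <= B) ->
  mu.-integrable setT (EFin \o g).
Proof.
move=> mg gB; apply: measurable_bounded_integrable => //.
  by rewrite [X in (X < _)%E]probability_setT ltry.
exists B; split; first exact: num_real.
by move=> y By x _; apply: le_trans (gB x) (ltW By).
Qed.

Lemma measurable_cos_phase (k : m.-tuple int) (b : R) :
  measurable_fun setT (fun x => cos (phase k x + b)).
Proof.
apply: (measurableT_comp (@measurable_cos R)).
by apply: measurable_funD => //; exact: measurable_phase.
Qed.

Lemma integral_haar_cos (k : m.-tuple int) (a b : R) :
  (\int[mu]_x (a * cos (phase k x + b))%:E =
   (if k == [tuple 0 | j < m] then a * cos b else 0)%:E)%E.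
Proof.
have ic : mu.-integrable setT (EFin \o (fun x => cos (phase k x + b))).
  apply: (@integrable_bounded _ 1); first exact: measurable_cos_phase.
  by move=> x; rewrite ler_norml cos_geN1 cos_le1.
have i1 : mu.-integrable setT (EFin \o cst (1 : R)).
  by apply: (@integrable_bounded _ 1) => // x; rewrite normr1.
have E : (\int[mu]_x (cos (phase k x + b))%:E =
   (if k == [tuple 0 | j < m] then cos b else 0)%:E)%E.
  have := integral_haar_cos_ge0 k b.
  under eq_integral do rewrite EFinD.
  have c1 : (\int[mu]_x (1 : R)%:E = 1)%E.
    by rewrite integral_cst // [X in (_ * X)%E]probability_setT mule1.
  rewrite (integralD _ i1 ic) // [X in (X + _)%E]c1.
  set I := (\int[mu]_x _)%E => H.
  have -> : I = ((1 + I) - 1)%E by rewrite [(1 + I)%E]addeC addeK.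
  by rewrite H -EFinB; case: eqP => _; congr (_%:E); ring.
under eq_integral do rewrite EFinM.
rewrite integralZl // E -EFinM; case: eqP => //; by rewrite mulr0.
Qed.

(** Sines appear as cosines shifted by pi / 2, so that [integral_haar_cos] covers both parts. *)
Lemma normc_trig_poly_sq (F : {fset m.-tuple int}) (c : m.-tuple int -> R[i]) x :
  normc (trig_poly F c x) ^+ 2 =
  \sum_(p <- [seq (k, l) | k <- F, l <- F])
    let k := [tuple tnth p.1 j - tnth p.2 j | j < m] in
    let w := c p.1 * (c p.2)^* in
    (complex.Re w * cos (phase k x + 0) + - complex.Im w * cos (phase k x + - (pi / 2))).
Proof.
have -> : normc (trig_poly F c x) ^+ 2
  = complex.Re (trig_poly F c x * (trig_poly F c x)^*).
  by case: (trig_poly F c x) => a b; rewrite normc_sq /= mulrN opprK !expr2.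
have -> : trig_poly F c x * (trig_poly F c x)^*
  = \sum_(p <- [seq (k, l) | k <- F, l <- F])
     (c p.1 * (c p.2)^* * expchar [tuple tnth p.1 j - tnth p.2 j | j < m] x).
  rewrite big_allpairs /trig_poly mulr_suml; apply: eq_bigr => k _.
  rewrite rmorph_sum mulr_sumr; apply: eq_bigr => l _ /=.
  by rewrite expchar_sub rmorphM mulrACA.
rewrite sum_Re; apply: eq_bigr => p _ /=.
set k := [tuple _ | j < m]; case: (c p.1 * _) => a b /=.
rewrite addr0 -/(phase k x) -[in sin _](subrK (pi / 2) (phase k x)) sinDpihalf.
by rewrite mulNr.
Qed.

Lemma measurable_normc_trig_poly_sq (F : {fset m.-tuple int}) c :
  measurable_fun setT (fun x : m.-tuple R => normc (trig_poly F c x) ^+ 2).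
Proof.
under eq_fun do rewrite normc_trig_poly_sq.
apply: measurable_sum => p.
by apply: measurable_funD; apply: measurable_funM => //; exact: measurable_cos_phase.
Qed.

(** Parseval's identity: off the diagonal the frequency difference is nonzero and the integral
    vanishes; on it the shifted cosine contributes cos (- pi / 2) = 0. *)
Lemma integral_haar_trig_poly_sq (F : {fset m.-tuple int}) c :
  (\int[mu]_x (normc (trig_poly F c x) ^+ 2)%:E
   = (\sum_(k <- F) normc (c k) ^+ 2)%:E)%E.
Proof.
under eq_integral do rewrite normc_trig_poly_sq -sumEFin.
have icos a k b : mu.-integrable setT (EFin \o (fun x => a * cos (phase k x + b))).
  apply: (@integrable_bounded _ `|a|).
    by apply: measurable_funM => //; exact: measurable_cos_phase.
  by move=> x; rewrite normrM ler_piMr // ler_norml cos_geN1 cos_le1.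
rewrite integral_sum //; last first.
  move=> p; under eq_fun do rewrite EFinD.
  by apply: integrableD => //; exact: icos.
under eq_bigr => p _.
  under eq_integral do rewrite EFinD.
  rewrite integralD //; try exact: icos.
  rewrite !integral_haar_cos cos0 mulr1 cosN cos_pihalf mulr0 if_same adde0; over.
rewrite sumEFin big_allpairs /=; congr (_%:E).
rewrite big_seq [RHS]big_seq; apply: eq_bigr => k kF.
have E l : ([tuple tnth k j - tnth l j | j < m] == [tuple 0 | j < m]) = (l == k).
  apply/eqP/eqP => [H|->]; last first.
    by apply: eq_from_tnth => j; rewrite !tnth_mktuple subrr.
  apply: eq_from_tnth => j; apply/eqP; rewrite eq_sym -subr_eq0.
  by move: (congr1 (fun t => tnth t j) H); rewrite !tnth_mktuple => ->.
rewrite (bigD1_seq k) ?fset_uniq //= E eqxx big1 ?addr0; last first.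
  by move=> l /negbTE lk; rewrite E lk.
by case: (c k) => a b; rewrite normc_sq /= mulrN opprK !expr2.
Qed.

Lemma measurable_trig_poly_small (F : {fset m.-tuple int}) c (t : R) : 0 <= t ->
  measurable [set x : m.-tuple R | normc (trig_poly F c x) < t].
Proof.
move=> t0; rewrite (_ : [set x | _] =
    (fun x => normc (trig_poly F c x) ^+ 2) @^-1` `]-oo, t ^+ 2[%classic).
  rewrite -[X in measurable X]setTI.
  by apply: measurable_normc_trig_poly_sq => //; exact: measurable_itv.
by apply/seteqP; split=> x /=; rewrite in_itv /= ltr_pXn2r ?nnegrE ?normc_ge0.
Qed.

(* An additive form of the Paley-Zygmund inequality. *)
Lemma haar_trig_poly_small (F : {fset m.-tuple int}) c (t S : R) :
  0 <= t -> (forall x : m.-tuple R, normc (trig_poly F c x) <= S) ->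
  exists q : R, [/\ mu [set x | normc (trig_poly F c x) < t] = q%:E, 0 <= q <= 1 &
    \sum_(k <- F) normc (c k) ^+ 2 <= t ^+ 2 * q + S ^+ 2 * (1 - q)].
Proof.
move=> t0 hS; set C := [set x | _].
have S0 : 0 <= S.
  exact: le_trans (normc_ge0 _) (hS [tuple 0 | j < m]).
have mC : measurable C by exact: measurable_trig_poly_small.
have Cfin : mu C \is a fin_num by exact: fin_num_measure.
exists (fine (mu C)); rewrite fineK //.
have q01 : 0 <= fine (mu C) <= 1.
  by rewrite fine_ge0 //= -lee_fin fineK // probability_le1.
split=> //.
rewrite -lee_fin -integral_haar_trig_poly_sq.
have mI A : measurable A -> mu.-integrable setT (EFin \o (\1_A : _ -> R)).
  move=> mA; apply: (@integrable_bounded _ 1); first exact: measurable_indic.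
  by move=> x; rewrite indicE; case: (_ \in _); rewrite ?normr0 ?normr1.
apply: (@le_trans _ _ (\int[mu]_x ((t ^+ 2)%:E * (\1_C x)%:E
                                   + (S ^+ 2)%:E * (\1_(~` C) x)%:E))%E).
  apply: ge0_le_integral => //.
  - by move=> x _; rewrite lee_fin sqr_ge0.
  - by apply/measurable_EFinP; exact: measurable_normc_trig_poly_sq.
  - apply: emeasurable_funD; apply: emeasurable_funM => //;
      by apply/measurable_EFinP; apply: measurable_indic => //; exact: measurableC.
  move=> x _; rewrite -!EFinM -EFinD lee_fin !indicE in_setC.
  case: (boolP (x \in C)) => [|xC] /=; rewrite ?mulr1 ?mulr0 ?addr0 ?add0r.
    rewrite inE => xC; rewrite ler_pXn2r ?nnegrE ?normc_ge0 //; exact: ltW.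
  by rewrite ler_pXn2r ?nnegrE ?normc_ge0.
rewrite integralD //; [|by apply: integrableZl => //; apply: mI; try exact: measurableC..].
rewrite !integralZl //; try (by apply: mI; try exact: measurableC).
rewrite !integral_indic ?setIT //; try exact: measurableC.
have muCC : mu (~` C) = (1 - fine (mu C))%:E.
  by rewrite probability_setC // EFinB fineK.
rewrite [X in (_ + _ * X)%E]muCC.
by rewrite -[X in (_ * X + _)%E](fineK Cfin) -!EFinM -EFinD.
Qed.

End second_moment.


(** * Fourier coefficients at an anchor *)

Section merged_characters.
Variables (d : nat) (u : {set 'I_d}).

Lemma coord_enum_val (T : Type) (x0 : T) (v : {set 'I_d}) (x : #|v|.-tuple T) (i : 'I_#|v|) :
  Defs.coord x0 v x (enum_val i) = tnth x i.
Proof.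
rewrite /Defs.coord (enum_val_nth (enum_val i)) index_uniq ?enum_uniq -?cardE //.
by rewrite (tnth_nth x0).
Qed.

Definition join_freq (k : #|u|.-tuple int) (q : #|~: u|.-tuple int) : d.-tuple int :=
  [tuple if j \in u then Defs.coord 0 u k j else Defs.coord 0 (~: u) q j | j < d].

Lemma join_freq_proj (l : d.-tuple int) :
  join_freq (freq_proj u l) (freq_proj (~: u) l) = l.
Proof.
apply: eq_from_tnth => j; rewrite tnth_mktuple; case: ifPn => ju.
  by rewrite -(enum_rankK_in ju ju) coord_enum_val tnth_mktuple.
have ju' : j \in ~: u by rewrite inE.
by rewrite -(enum_rankK_in ju' ju') coord_enum_val tnth_mktuple.
Qed.

Variable R : realType.

Lemma expchar_merge (l : d.-tuple int) (x : #|u|.-tuple R) (xi : #|~: u|.-tuple R) :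
  expchar l (merge_pt u x xi)
    = expchar (freq_proj u l) x * expchar (freq_proj (~: u) l) xi.
Proof.
have E : \sum_(j < d) (tnth l j)%:~R * tnth (merge_pt u x xi) j =
   \sum_(j < #|u|) (tnth (freq_proj u l) j)%:~R * tnth x j +
   \sum_(j < #|~: u|) (tnth (freq_proj (~: u) l) j)%:~R * tnth xi j.
  rewrite (bigID (mem u)) /=; congr (_ + _).
    rewrite big_enum_val /=; apply: eq_bigr => i _.
    by rewrite !tnth_mktuple enum_valP coord_enum_val.
  rewrite (eq_bigl (mem (~: u))) => [|j]; last by rewrite !inE.
  rewrite big_enum_val /=; apply: eq_bigr => i _.
  have := enum_valP i; rewrite inE => /negbTE iu.
  by rewrite !tnth_mktuple iu coord_enum_val.
rewrite /expchar E mulrDr; set a := 2 * pi * _; set b := 2 * pi * _.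
by apply/eqP; rewrite eq_complex /= cosD sinD [X in _ && (_ == X)]addrC !eqxx.
Qed.

End merged_characters.

(** * Truncation of unconditional sums and of Fourier projections *)

Section summation.
Variables (R : realType) (T : choiceType).
Implicit Types (b : T -> R) (A B : set T).

Lemma esum_subset A B b : (forall i, 0 <= b i) -> A `<=` B ->
  (\esum_(i in A) (b i)%:E <= \esum_(i in B) (b i)%:E)%E.
Proof.
move=> b0 AB; rewrite [leRHS](esumID A); last by move=> i _; rewrite lee_fin.
by rewrite setIidr // leeDl // esum_ge0 // => i _; rewrite lee_fin.
Qed.

Lemma esum_fsetE (G : {fset T}) b : (forall i, 0 <= b i) ->
  \esum_(i in [set` G]) (b i)%:E = (\sum_(i <- G) b i)%:E.
Proof.
move=> b0; rewrite esum_fset //; last by move=> i _; rewrite lee_fin.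
by rewrite fsbig_finite // set_fsetK sumEFin.
Qed.

Lemma esum_tail A b (eta : R) : (forall i, 0 <= b i) -> 0 < eta ->
  (\esum_(i in A) (b i)%:E < +oo)%E ->
  exists G : {fset T}, [set` G] `<=` A /\
    (\esum_(i in A `&` ~` [set` G]) (b i)%:E <= eta%:E)%E.
Proof.
move=> b0 eta0 Afin.
have b0' i : (0 <= (b i)%:E)%E by rewrite lee_fin.
have Afn : \esum_(i in A) (b i)%:E \is a fin_num.
  by rewrite ge0_fin_numE // esum_ge0.
have [_ [X [finX XA] <-] lt] := ub_ereal_sup_adherent eta0 Afn.
exists (fset_set X); rewrite fset_setK //; split=> //.
rewrite -esum_fset // in lt.
move: lt; rewrite -/(esum _ _) [X in (X - _)%E](esumID X) // setIidr // => lt.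
have Xfn : \esum_(i in X) (b i)%:E \is a fin_num.
  rewrite ge0_fin_numE ?esum_ge0 //.
  by apply: le_lt_trans Afin; apply: esum_subset.
rewrite -(@leeD2lE _ (\esum_(i in X) (b i)%:E)) //.
rewrite -leeBlDr //; exact: ltW.
Qed.

(** Truncating the positive and the negative part loses a number in [0, eta] each; the difference of
    two such numbers is again at most eta in absolute value. *)
Lemma rsum_approx (L : set T) (a : T -> R) (G : {fset T}) (b : T -> R) (eta : R) :
  (forall i, `|a i| <= b i) -> (\esum_(i in L) (b i)%:E < +oo)%E -> 
  [set` G] `<=` L ->
  (\esum_(i in L `&` ~` [set` G]) (b i)%:E <= eta%:E)%E ->
  `|(fine (\esum_(k in L) (Num.max (a k) 0)%:E)
     - fine (\esum_(k in L) (Num.max (- a k) 0)%:E)) - \sum_(k <- G) a k| <= eta.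
Proof.
move=> ab Lfin GL tail.
have b0 i : 0 <= b i by apply: le_trans (ab i).
have part (c : T -> R) : (forall i, 0 <= c i <= b i) -> exists t, 0 <= t <= eta /\
    fine (\esum_(k in L) (c k)%:E) = \sum_(k <- G) c k + t.
  move=> cb; have c0 i : 0 <= c i by case/andP: (cb i).
  have c0' i : (0 <= (c i)%:E)%E by rewrite lee_fin.
  set t := \esum_(i in L `&` ~` [set` G]) (c i)%:E.
  have tle : (t <= eta%:E)%E.
    by apply: le_trans tail; apply: le_esum => i _; rewrite lee_fin; case/andP: (cb i).
  have t0 : (0 <= t)%E by apply: esum_ge0.
  have tfin : t \is a fin_num.
    by rewrite ge0_fin_numE // (le_lt_trans tle) // ltry.
  exists (fine t); split.
    by rewrite fine_ge0 //= -lee_fin fineK.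
  by rewrite (esumID [set` G]) // setIidr // esum_fsetE // -/t -(fineK tfin).
have [|t1 [/andP[t10 t1e] ->]] := part (fun k => Num.max (a k) 0).
  by move=> i; rewrite le_max lexx orbT ge_max b0 andbT (le_trans (ler_norm _) (ab i)).
have [|t2 [/andP[t20 t2e] ->]] := part (fun k => Num.max (- a k) 0).
  move=> i; rewrite le_max lexx orbT ge_max b0 andbT.
  by rewrite (le_trans (ler_norm _)) // normrN.
have -> : \sum_(k <- G) a k
        = \sum_(k <- G) Num.max (a k) 0 - \sum_(k <- G) Num.max (- a k) 0.
  rewrite -sumrB; apply: eq_bigr => k _.
  case: (lerP 0 (a k)) => h; first by rewrite (max_r (_ : - a k <= 0)) ?oppr_le0 // subr0.
  by rewrite (max_l (_ : 0 <= - a k)) ?oppr_ge0 ?ltW // sub0r opprK.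
by rewrite ler_norml; lra.
Qed.

End summation.

Section fourier_approximation.
Variables (R : realType) (m : nat) (f : m.-tuple R -> R[i]).
Local Notation fc := (fourier_coef f).

Lemma abs_Re_le (z : R[i]) : `|complex.Re z| <= normc z.
Proof.
rewrite -(@ler_pXn2r _ 2) ?nnegrE ?normc_ge0 // normc_sq real_normK ?num_real //.
by rewrite lerDl sqr_ge0.
Qed.

Lemma abs_Im_le (z : R[i]) : `|complex.Im z| <= normc z.
Proof.
rewrite -(@ler_pXn2r _ 2) ?nnegrE ?normc_ge0 // normc_sq real_normK ?num_real //.
by rewrite lerDr sqr_ge0.
Qed.

Lemma normc_le_ReIm (z : R[i]) : normc z <= `|complex.Re z| + `|complex.Im z|.
Proof.
rewrite -(@ler_pXn2r _ 2) ?nnegrE ?normc_ge0 ?addr_ge0 // normc_sq sqrrD.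
rewrite !real_normK ?num_real // addrAC lerDl mulrn_wge0 // mulr_ge0 //.
Qed.

Lemma sum_Im (I : Type) (s : seq I) (F : I -> R[i]) :
  complex.Im (\sum_(i <- s) F i) = \sum_(i <- s) complex.Im (F i).
Proof.
elim: s => [|i s IH]; rewrite ?big_nil ?big_cons // -IH.
by case: (F i) (\sum_(_ <- _) _) => [? ?] [? ?].
Qed.

(** One eta for the real part and one for the imaginary part. *)
Lemma fourier_proj_approx (L : set (m.-tuple int)) (G : {fset m.-tuple int})
    (eta : R) x :
  (\esum_(k in L) (normc (fc k))%:E < +oo)%E -> [set` G] `<=` L ->
  (\esum_(k in L `&` ~` [set` G]) (normc (fc k))%:E <= eta%:E)%E ->
  normc (fourier_proj L f x - \sum_(k <- G) fc k * expchar k x) <= 2 * eta.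
Proof.
move=> Lfin GL tail; apply: le_trans (normc_le_ReIm _) _.
have ne k : normc (fc k * expchar k x) = normc (fc k).
  by rewrite normcM normc_expchar mulr1.
have -> : 2 * eta = eta + eta by ring.
have ReB (a b : R[i]) : complex.Re (a - b) = complex.Re a - complex.Re b.
  by case: a b => [? ?] [? ?].
have ImB (a b : R[i]) : complex.Im (a - b) = complex.Im a - complex.Im b.
  by case: a b => [? ?] [? ?].
rewrite ReB ImB sum_Re sum_Im; apply: lerD.
  by apply: rsum_approx Lfin GL tail => k; rewrite -ne abs_Re_le.
by apply: rsum_approx Lfin GL tail => k; rewrite -ne abs_Im_le.
Qed.

End fourier_approximation.

Section anchors.
Variables (R : realType) (d : nat) (f : d.-tuple R -> R[i]) (u : {set 'I_d}).
Local Notation fc := (fourier_coef f).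

(* The coefficient of [k] of the function [x |-> f (x, xi)], truncated to the
   frequencies in [G]. *)
Definition partial_coef (G : {fset d.-tuple int}) (k : #|u|.-tuple int)
    (xi : #|~: u|.-tuple R) : R[i] :=
  \sum_(l <- G | freq_proj u l == k) fc l * expchar (freq_proj (~: u) l) xi.

(** Among the frequencies that project to k, the complementary coordinates are injective, with
    inverse [join_freq k]; hence no two terms collide and Parseval applies to the coefficients as
    they stand. *)
Lemma partial_coef_trig_poly G k (xi : #|~: u|.-tuple R) :
  partial_coef G k xi =
  trig_poly [fset freq_proj (~: u) l | l in [fset l in G | freq_proj u l == k]]%fset
    (fun q => fc (join_freq k q)) xi.
Proof.
rewrite /trig_poly big_imfset /=; last first.
  move=> l l'; rewrite !inE /= => /andP[_ /eqP lk] /andP[_ /eqP l'k] E.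
  by rewrite -(join_freq_proj u l) -(join_freq_proj u l') lk l'k E.
rewrite /partial_coef big_fset_condE; apply: eq_fbigr => l.
by rewrite !inE /= => /andP[_ /eqP <-] _; rewrite join_freq_proj.
Qed.

Lemma sum_partial_coef (G : {fset d.-tuple int}) (J : {fset #|u|.-tuple int}) x xi :
  trig_poly J (partial_coef G ^~ xi) x =
  \sum_(l <- G | freq_proj u l \in J) fc l * expchar l (merge_pt u x xi).
Proof.
rewrite /trig_poly.
under eq_bigr do rewrite /partial_coef mulr_suml big_mkcond.
rewrite exchange_big [RHS]big_mkcond /=; apply: eq_bigr => l _.
case: ifPn => lJ.
  rewrite (bigD1_seq (freq_proj u l)) ?fset_uniq //= eqxx big1 ?addr0 => [|k kl].
    by rewrite expchar_merge -mulrA [X in _ * X]mulrC.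
  by rewrite eq_sym (negbTE kl).
rewrite big_seq big1 // => k kJ; case: eqP => // E.
by move: lJ; rewrite E kJ.
Qed.

End anchors.


(** * The probability that an anchor misses a frequency *)

Section anchor_probability.
Variables (R : realType) (d : nat) (f : d.-tuple R -> R[i]) (u : {set 'I_d}).
Variable delta : R.
Hypothesis delta0 : 0 < delta.
Local Notation fc := (fourier_coef f).
Local Notation FI := (fset_set (large_freqs delta f)).

Lemma sum_sq_le (T : Type) (s : seq T) (b : T -> R) :
  (\sum_(i <- s) b i) ^+ 2 <= (size s)%:R * \sum_(i <- s) b i ^+ 2.
Proof.
have sumc (c : R) : \sum_(i <- s) c = (size s)%:R * c.
  by rewrite big_const_seq count_predT iter_addr_0 mulr_natl.
have h : 0 <= \sum_(i <- s) \sum_(j <- s) (b i - b j) ^+ 2.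
  by apply: sumr_ge0 => i _; apply: sumr_ge0 => j _; rewrite sqr_ge0.
have E : \sum_(i <- s) \sum_(j <- s) (b i - b j) ^+ 2 =
  2 * ((size s)%:R * (\sum_(i <- s) b i ^+ 2) - (\sum_(i <- s) b i) ^+ 2).
  have inner i : \sum_(j <- s) (b i - b j) ^+ 2
      = (size s)%:R * b i ^+ 2 + (- 2 * \sum_(j <- s) b j) * b i
        + \sum_(j <- s) b j ^+ 2.
    under eq_bigr => j _.
      rewrite (_ : (b i - b j) ^+ 2 = b i ^+ 2 + (- 2 * b i) * b j + b j ^+ 2);
        last by ring.
      over.
    by rewrite !big_split /= sumc -mulr_sumr; ring.
  under eq_bigr do rewrite inner.
  by rewrite !big_split /= sumc -!mulr_sumr; ring.
by move: h; rewrite E pmulr_rge0 // subr_ge0.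
Qed.

(** Solved for 1 - q, the moment inequality gives 1 - q >= (A1 - t2) / B with B = 2 n A1 + 2 s2 d2.
    The excess 2 d2 tau allowed in t2 costs at most tau, since B >= 2 d2. *)
Lemma moment_bound_aux (n A1 s2 d2 t2 q tau Q : R) :
  1 <= n -> 0 < d2 -> d2 <= A1 -> 0 <= s2 -> 0 <= tau -> 0 <= q <= 1 -> 0 <= t2 ->
  t2 <= d2 / 2 + 2 * d2 * tau -> Q <= 2 * (n * A1) + 2 * (s2 * d2) ->
  A1 <= t2 * q + Q * (1 - q) ->
  q <= 1 - (4 * (n + s2))^-1 + tau.
Proof.
move=> n1 d20 dA s20 tau0 /andP[q0 q1] t20 ht hQ hA.
have D0 : 0 < 4 * (n + s2) by rewrite mulr_gt0 // ltr_pwDl // (lt_le_trans ltr01).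
have B2 : 2 * d2 <= 2 * (n * A1) + 2 * (s2 * d2).
  have A0 : 0 <= A1 by apply: le_trans dA; rewrite ltW.
  rewrite -[X in X <= _]addr0 lerD ?mulr_ge0 ?(ltW d20) // ler_pM2l //.
  by apply: le_trans dA _; rewrite ler_peMl.
(* The quotient of A1 - d2 / 2 by B increases with A1 and equals 1 / (4 (n + s2)) at A1 = d2. This
   is the origin of the factor 4 in [enough_anchors]. *)
have BD : (2 * (n * A1) + 2 * (s2 * d2)) / (4 * (n + s2)) <= A1 - d2 / 2.
  rewrite ler_pdivrMr // -subr_ge0.
  have -> : (A1 - d2 / 2) * (4 * (n + s2)) - (2 * (n * A1) + 2 * (s2 * d2))
     = (2 * n + 4 * s2) * (A1 - d2) by field.
  by rewrite mulr_ge0 ?subr_ge0 // addr_ge0 // mulr_ge0 // (le_trans ler01).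
move: (2 * (n * A1) + 2 * (s2 * d2)) hQ B2 BD => B hQ B2 BD.
have Bp : 0 < B by apply: lt_le_trans B2; rewrite mulr_gt0.
have h1 : A1 - t2 <= B * (1 - q).
  have h2 : Q * (1 - q) <= B * (1 - q) by rewrite ler_wpM2r // subr_ge0.
  have h3 : t2 * q <= t2 by rewrite ler_piMr.
  by rewrite lerBlDr; apply: le_trans hA _; rewrite addrC lerD.
have h5 : 2 * d2 * tau <= B * tau by rewrite ler_wpM2r.
rewrite -(ler_pM2l Bp) -subr_ge0.
have -> : B * (1 - (4 * (n + s2))^-1 + tau) - B * q =
  B * (1 - q) - B / (4 * (n + s2)) + B * tau by ring.
move: (B * (1 - q)) (B / (4 * (n + s2))) (B * tau) (2 * d2 * tau) BD h1 h5 ht.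
by clear; move=> x y z v; lra.
Qed.

Lemma moment_bound (n A1 B1 S t q tau : R) :
  1 <= n -> delta ^+ 2 <= A1 -> 0 <= tau -> B1 ^+ 2 <= n * A1 -> 0 <= q <= 1 ->
  t ^+ 2 <= delta ^+ 2 / 2 + 2 * delta ^+ 2 * tau ->
  A1 <= t ^+ 2 * q + (B1 + S) ^+ 2 * (1 - q) ->
  q <= 1 - (4 * (n + (delta ^+ 2)^-1 * S ^+ 2))^-1 + tau.
Proof.
move=> n1 dA tau0 B1A q01 ht; have d2 : 0 < delta ^+ 2 by rewrite exprn_gt0.
apply: (moment_bound_aux n1 d2 dA) => //; rewrite ?sqr_ge0 //.
  by rewrite mulr_ge0 ?sqr_ge0 // invr_ge0 ltW.
have -> : (delta ^+ 2)^-1 * S ^+ 2 * delta ^+ 2 = S ^+ 2.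
  by rewrite mulrAC mulVf ?mul1r // lt0r_neq0.
apply: (@le_trans _ _ (2 * B1 ^+ 2 + 2 * S ^+ 2)); last by rewrite lerD2r ler_pM2l.
rewrite -subr_ge0 (_ : _ - _ = (B1 - S) ^+ 2) ?sqr_ge0 //.
by ring.
Qed.

(** The sup norm is at most B1 + S, B1 coming from at most |I_delta| large coefficients, so B1^2 <=
    |I_delta| A1 by Cauchy-Schwarz. The second moment is at least A1, and A1 >= delta^2 because k is
    the projection of a large frequency. *)
Lemma partial_coef_small (G : {fset d.-tuple int}) (S t tau : R) k :
  finite_set (large_freqs delta f) -> {subset FI <= G} ->
  0 <= S -> \sum_(l <- G | l \notin FI) normc (fc l) <= S ->
  0 <= tau -> 0 <= t -> t ^+ 2 <= delta ^+ 2 / 2 + 2 * delta ^+ 2 * tau ->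
  projection u (large_freqs delta f) k ->
  exists q : R,
   [/\ haar R #|~: u| [set xi | normc (partial_coef f G k xi) < t] = q%:E, 0 <= q <= 1 &
    q <= 1 - (4 * (#|` FI|%:R + (delta ^+ 2)^-1 * S ^+ 2))^-1 + tau].
Proof.
move=> Ifin FIG S0 GS tau0 t0 ht [l0 l0I l0k].
have l0F : l0 \in FI by rewrite in_fset_set // inE.
set Gk := [fset l in G | freq_proj u l == k]%fset.
pose B1 : R := \sum_(l <- Gk | l \in FI) normc (fc l).
pose A1 : R := \sum_(l <- Gk | l \in FI) normc (fc l) ^+ 2.
have nsz : (size [seq l <- Gk | l \in FI] <= #|` FI|)%N.
  apply: uniq_leq_size; first by rewrite filter_uniq ?fset_uniq.
  by move=> l; rewrite mem_filter => /andP[].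
have bound xi : normc (partial_coef f G k xi) <= B1 + S.
  rewrite /partial_coef big_fset_condE -/Gk.
  apply: (@le_trans _ _ (\sum_(l <- Gk) normc (fc l))).
    elim/big_ind2 : _ => [|x a y b xa yb|l _]; first by rewrite normc0.
      by apply: le_trans (le_normcD _ _) _; exact: lerD.
    by rewrite normcM normc_expchar mulr1.
  rewrite (bigID (mem FI)) /= lerD2l; apply: le_trans GS.
  rewrite [leLHS]big_mkcond /Gk -big_fset_condE big_mkcond [leRHS]big_mkcond /=.
  apply: ler_sum => l _; case: ifP => // _; case: ifP => // _; exact: normc_ge0.
have A1d : delta ^+ 2 <= A1.
  have l0G : l0 \in Gk by rewrite !inE /= (FIG _ l0F) l0k eqxx.
  rewrite /A1 big_mkcond (bigD1_seq l0) ?fset_uniq //= l0F.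
  apply: (@le_trans _ _ (normc (fc l0) ^+ 2)); last first.
    by rewrite lerDl; apply: sumr_ge0 => l _; case: ifP => // _; exact: sqr_ge0.
  by rewrite ler_pXn2r ?nnegrE ?normc_ge0 ?(ltW delta0).
have n1 : 1 <= #|` FI|%:R :> R.
  by rewrite ler1n cardfs_gt0; apply/fset0Pn; exists l0.
have B1A : B1 ^+ 2 <= #|` FI|%:R * A1.
  have := sum_sq_le [seq l <- Gk | l \in FI] (fun l => normc (fc l)).
  rewrite !big_filter => /le_trans; apply.
  by rewrite ler_wpM2r ?ler_nat // sumr_ge0 // => l _; exact: sqr_ge0.
have bound' (xi : #|~: u|.-tuple R) : normc (trig_poly
    [fset freq_proj (~: u) l | l in Gk]%fset (fun q => fc (join_freq k q)) xi) <= B1 + S.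
  by rewrite -partial_coef_trig_poly.
have [q [qE q01 hq]] := haar_trig_poly_small t0 bound'.
exists q; split=> //.
  rewrite -qE; congr (haar R _ _); apply/seteqP; split=> xi /=;
    by rewrite partial_coef_trig_poly.
apply: (moment_bound n1 A1d tau0 B1A q01 ht); apply: le_trans hq.
rewrite big_imfset /=; last first.
  move=> l l'; rewrite !inE /= => /andP[_ /eqP lk] /andP[_ /eqP l'k] E.
  by rewrite -(join_freq_proj u l) -(join_freq_proj u l') lk l'k E.
rewrite /A1 big_mkcond /= -/Gk big_seq [leRHS]big_seq; apply: ler_sum => l.
rewrite !inE /= => /andP[_ /eqP lk].
by rewrite -lk join_freq_proj; case: ifP => // _; exact: sqr_ge0.
Qed.

End anchor_probability.

Lemma threshold_scale_aux (R : realType) (x y z w : R) :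
  0 <= z -> x <= z / 2 -> y <= z -> z <= w -> 2 * x + y / 4 <= 2 * w.
Proof. by lra. Qed.

Section detection_scale.
Variables (R : realType) (d : nat) (f : d.-tuple R -> R[i]) (eps delta : R) (r : nat).
Hypotheses (eps0 : 0 < eps) (eps1 : eps < 1) (delta0 : 0 < delta) (r0 : (0 < r)%N).
Local Notation fc := (fourier_coef f).
Local Notation I := (large_freqs delta f).
Local Notation n := (#|` fset_set I|).

(** The logarithmic factor is positive here, so a divergent series would make the lower bound for
    the finite number r infinite. *)
Lemma enough_anchors_real : (0 < n)%N -> enough_anchors f eps delta r ->
  exists S : R, [/\ 0 <= S, \esum_(k in ~` I) (normc (fc k))%:E = S%:E &
    4 * (n%:R + (delta ^+ 2)^-1 * S ^+ 2) * (ln n%:R + ln eps^-1) <= r%:R].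
Proof.
move=> n0; rewrite /enough_anchors.
have nR : 0 < n%:R :> R by rewrite ltr0n.
have lp : 0 < ln n%:R + ln eps^-1.
  rewrite ltr_wpDl ?ln_ge0 ?ler1n // ln_gt0 // invf_gt1 //.
have dI : 0 < (delta ^+ 2)^-1 by rewrite invr_gt0 exprn_gt0.
have: (0 <= \esum_(k in ~` I) (normc (fc k))%:E)%E.
  by apply: esum_ge0 => k _; rewrite lee_fin normc_ge0.
case: (\esum_(k in ~` I) (normc (fc k))%:E) => [S|_|//].
  rewrite lee_fin => S0 h; exists S; split=> //.
  by move: h; rewrite lne_EFin // -EFin_expe -!(EFinM, EFinD) lee_fin.
rewrite lne_EFin // -EFinD expe2 mulyy gt0_muley ?lte_fin // addey // gt0_muley ?lte_fin //.
by rewrite gt0_mulye ?lte_fin // leye_eq.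
Qed.

(** By 1 + x <= exp x, r anchors give exp (- r / (4 D)) exp (r tau); the first factor is at most eps
    / n, and tau = ln (9/8) / r makes the second one 9/8. *)
Lemma miss_probability (D : R) : (0 < n)%N -> 0 < D ->
  4 * D * (ln n%:R + ln eps^-1) <= r%:R ->
  exists tau : R, 0 < tau /\
   forall q, 0 <= q -> q <= 1 - (4 * D)^-1 + tau -> n%:R * q ^+ r <= 9 / 8 * eps.
Proof.
move=> n0 D0 hr.
have nR : 0 < n%:R :> R by rewrite ltr0n.
have rR : 0 < r%:R :> R by rewrite ltr0n.
exists (ln (9 / 8) / r%:R); split.
  by rewrite divr_gt0 // ln_gt0 //; lra.
move=> q q0 hq.
set tau := _ / r%:R in hq.
have q1 : q <= expR (- (4 * D)^-1 + tau).
  by apply: le_trans hq _; rewrite -addrA expR_ge1Dx.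
have q2 : q ^+ r <= expR (- (4 * D)^-1 + tau) ^+ r.
  by rewrite ler_pXn2r ?nnegrE ?expR_ge0.
apply: (@le_trans _ _ (n%:R * (expR (- (4 * D)^-1 + tau) ^+ r))).
  by rewrite ler_pM2l.
rewrite -expRM_natl mulrDr expRD.
have -> : r%:R * tau = ln (9 / 8) by rewrite /tau mulrCA mulfV ?mulr1 ?lt0r_neq0.
rewrite lnK ?posrE; last by lra.
rewrite mulrA mulrC; apply: ler_wpM2l; first by lra.
have h : ln n%:R + ln eps^-1 <= r%:R * (4 * D)^-1.
  by rewrite ler_pdivlMr ?mulr_gt0 // mulrC.
apply: (@le_trans _ _ (n%:R * expR (- (ln n%:R + ln eps^-1)))).
  by rewrite ler_pM2l // ler_expR mulrN lerN2.
rewrite opprD expRD !expRN !lnK ?posrE ?invr_gt0 // invrK mulrA mulfV ?mul1r //.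
by rewrite lt0r_neq0.
Qed.

(** The margin 4 eta pays for the truncation error 2 eta, which least squares doubles; raising the
    level delta / sqrt 2 by it must stay within the slack tau of [moment_bound]. *)
Lemma threshold_scale (tau : R) : 0 < tau -> exists eta : R, 0 < eta /\
  (delta / Num.sqrt 2 + 4 * eta) ^+ 2 <= delta ^+ 2 / 2 + 2 * delta ^+ 2 * tau.
Proof.
move=> tau0; pose m := Num.min 1 tau.
have m0 : 0 < m by rewrite lt_min ltr01.
have m1 : m <= 1 by rewrite ge_min lexx.
have mt : m <= tau by rewrite ge_min lexx orbT.
exists (delta * m / 8); split; first by rewrite divr_gt0 // mulr_gt0.
set c := delta / Num.sqrt 2.
have c0 : 0 <= c by rewrite divr_ge0 ?sqrtr_ge0 // ltW.
have c2 : c ^+ 2 = delta ^+ 2 / 2 by rewrite exprMn exprVn sqr_sqrtr.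
have cd : c <= delta.
  rewrite -(@ler_pXn2r _ 2) ?nnegrE ?(ltW delta0) // c2.
  by rewrite ler_pdivrMr // ler_peMr ?sqr_ge0 // ler1n.
rewrite sqrrD c2 -addrA lerD2l.
have -> : 4 * (delta * m / 8) = delta * m / 2 by field.
have h1 : c * (delta * m / 2) <= delta * (delta * m / 2).
  by rewrite ler_wpM2r // divr_ge0 // mulr_ge0 ?(ltW delta0) ?(ltW m0).
have h2 : delta ^+ 2 * (m * m) <= delta ^+ 2 * m.
  by rewrite ler_wpM2l ?sqr_ge0 // ler_piMr // ltW.
have h3 : delta ^+ 2 * m <= delta ^+ 2 * tau by rewrite ler_wpM2l ?sqr_ge0.
have -> : (delta * m / 2) ^+ 2 = delta ^+ 2 * (m * m) / 4 by field.
have E : delta * (delta * m / 2) = delta ^+ 2 * m / 2 by field.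
rewrite E in h1; rewrite -mulr_natl.
have h0 : 0 <= delta ^+ 2 * m by rewrite mulr_ge0 ?sqr_ge0 // ltW.
have -> : 2 * delta ^+ 2 * tau = 2 * (delta ^+ 2 * tau) by ring.
exact: threshold_scale_aux h0 h1 h2 h3.
Qed.

(* Truncating the Fourier series to a finite set [G], up to [eta], avoids the
   measurability of infinite sums in what follows. *)
Lemma detection_scale :
  finite_set I -> (0 < n)%N -> enough_anchors f eps delta r ->
  exists eta : R, exists G : {fset d.-tuple int}, [/\ 0 < eta,
   forall (L : set (d.-tuple int)) x,
     normc (fourier_proj L f x - \sum_(l <- G | l \in L) fc l * expchar l x) <= 2 * eta &
   forall (u : {set 'I_d}) k, projection u I k -> exists q : R,
     [/\ haar R #|~: u| [set xi | normc (partial_coef f G k xi)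
            < delta / Num.sqrt 2 + 4 * eta] = q%:E,
         0 <= q & n%:R * q ^+ r <= 9 / 8 * eps]].
Proof.
move=> Ifin n0 /(enough_anchors_real n0)[S [S0 SE hr]].
have d2 : 0 < delta ^+ 2 by rewrite exprn_gt0.
have nR : 1 <= n%:R :> R by rewrite ler1n.
have D0 : 0 < n%:R + (delta ^+ 2)^-1 * S ^+ 2.
  by rewrite ltr_pwDl ?(lt_le_trans ltr01) // mulr_ge0 ?sqr_ge0 // invr_ge0 ltW.
have [tau [tau0 miss]] := miss_probability n0 D0 hr.
have [eta [eta0 etat]] := threshold_scale tau0.
have b0 k : 0 <= normc (fc k) by exact: normc_ge0.
have Sfin : (\esum_(k in ~` I) (normc (fc k))%:E < +oo)%E by rewrite SE ltry.
have [G' [G'I tail]] := esum_tail b0 eta0 Sfin.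
(* G contains all of I_delta, so what any L has outside G belongs to the small tail left by G'. *)
pose G := (fset_set I `|` G')%fset.
have allfin : (\esum_(k in setT) (normc (fc k))%:E < +oo)%E.
  rewrite (esumID I) ?setTI // => [|k _]; last by rewrite lee_fin.
  rewrite lte_add_pinfty // -(fset_setK Ifin) esum_fsetE // ltry //.
exists eta, G; split=> // [L x|u k kI].
  pose GL := [fset l in G | l \in L]%fset.
  have := @fourier_proj_approx _ _ f L GL eta x; rewrite /GL -big_fset_condE; apply.
  - exact: le_lt_trans (esum_subset b0 (@subsetT _ L)) allfin.
  - by move=> l; rewrite /= !inE /= => /andP[_]; rewrite inE.
  apply: le_trans tail; apply: esum_subset => // l [Ll]; rewrite /= !inE /= => /negP.
  rewrite mem_set // andbT => /norP[lI lG]; split; last by apply/negP.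
  by move=> Il; move/negP: lI; apply; rewrite in_fset_set // inE.
have FIG : {subset fset_set I <= G} by move=> l lI; rewrite in_fsetU lI.
have GS : \sum_(l <- G | l \notin fset_set I) normc (fc l) <= S.
  rewrite big_fset_condE -lee_fin -esum_fsetE // -SE; apply: esum_subset => // l.
  rewrite /= !inE /= in_fset_set // => /andP[_ /negP lI] Il.
  by apply: lI; rewrite inE.
have t0 : 0 <= delta / Num.sqrt 2 + 4 * eta.
  by rewrite addr_ge0 // ?divr_ge0 ?sqrtr_ge0 ?mulr_ge0 // ltW.
have [q [qE /andP[q0 q1] hq]] :=
  partial_coef_small delta0 Ifin FIG S0 GS (ltW tau0) t0 etat kI.
by exists q; split=> //; exact: miss.
Qed.

End detection_scale.


(** * Conditioning on countably many outcomes *)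

Section countable_partitions.
Variables (R : realType) (dOmega : measure_display).
Variables (Omega : measurableType dOmega) (P : probability Omega R).

Section fibers.
Variables (T : countType) (g : Omega -> T).
Hypothesis mg : forall t, measurable [set w | g w = t].

Let piece_eq n (A : set Omega) :
  A `&` [set w | choice.pickle (g w) = n] = set0 \/
  exists2 w0, A w0 & A `&` [set w | choice.pickle (g w) = n] = A `&` [set w | g w = g w0].
Proof.
have [[w0 [Aw0 n0]]|no] := pselect (exists w0, A w0 /\ choice.pickle (g w0) = n).
  right; exists w0 => //; apply/seteqP; split=> w [Aw /= E]; split=> //=.
    by apply: (pcan_inj choice.pickleK); rewrite E.
  by rewrite E.
by left; apply/seteqP; split=> // w [Aw E]; apply: no; exists w.
Qed.

Lemma measurable_fiber_pred (Q : set T) : measurable [set w | Q (g w)].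
Proof.
have -> : [set w | Q (g w)] = \bigcup_n ([set w | Q (g w)] `&` [set w | choice.pickle (g w) = n]).
  by apply/seteqP; split=> [w Qw|w [n _ []//]]; exists (choice.pickle (g w)).
apply: bigcup_measurable => n _.
have [->|[w0 Qw0 ->]] := piece_eq n [set w | Q (g w)]; first exact: measurable0.
rewrite (_ : _ `&` _ = [set w | g w = g w0]); first exact: mg.
by apply/seteqP; split=> [w []//|w /= E]; split=> //=; rewrite E.
Qed.

(** Total probability over the countably many values of g. Values not attained on A contribute
    nothing to the left side, so each fiber may be named by a point of A. *)
Lemma measure_le_fibers (A B : set Omega) (c : R) :
  measurable A -> measurable B -> 0 <= c ->
  (forall w0, A w0 -> (P (A `&` [set w | g w = g w0]) <=
                         c%:E * P (B `&` [set w | g w = g w0]))%E) ->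
  (P A <= c%:E * P B)%E.
Proof.
move=> mA mB c0 h.
have mp n : measurable [set w | choice.pickle (g w) = n].
  exact: (measurable_fiber_pred [set t | choice.pickle t = n]).
have split_ C : measurable C ->
    P C = (\sum_(0 <= n <oo) P (C `&` [set w | choice.pickle (g w) = n]))%E.
  move=> mC; rewrite -measure_semi_bigcup.
  - congr (P _); apply/seteqP; split=> [w Cw|w [n _ []//]].
    by exists (choice.pickle (g w)).
  - by move=> n; apply: measurableI.
  - apply/trivIsetP => i j _ _ ij; apply/seteqP; split=> // w [[_ /= E] [_ /= E']].
    by move: ij; rewrite -E -E' eqxx.
  - by apply: bigcup_measurable => n _; apply: measurableI.
rewrite (split_ A mA) (split_ B mB) -nneseriesZl; last first.
  by move=> n _; exact: measure_ge0.
apply: lee_nneseries => [n *|n *]; first exact: measure_ge0.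
have [->|[w0 Aw0 E]] := piece_eq n A.
  by rewrite measure0 mule_ge0 // ?lee_fin ?measure_ge0.
rewrite E; apply: le_trans (h _ Aw0) _.
rewrite lee_wpmul2l ?lee_fin // le_measure ?inE //.
- by apply: measurableI => //; exact: mg.
- by apply: measurableI.
move=> w [Bw /= gw]; split=> //=; rewrite gw.
have : (A `&` [set w | g w = g w0]) w0 by [].
by rewrite -E => -[].
Qed.

End fibers.

Lemma measurable_all_in (S : eqType) (s : seq S) (E : S -> set Omega) :
  (forall v, v \in s -> measurable (E v)) ->
  measurable [set w | forall v, v \in s -> E v w].
Proof.
elim: s => [_|v s IH mE].
  by rewrite (_ : [set w | _] = setT); [exact: measurableT|apply/seteqP; split].
rewrite (_ : [set w | _] = E v `&` [set w | forall x, x \in s -> E x w]).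
  apply: measurableI; first by apply: mE; rewrite mem_head.
  by apply: IH => x xs; apply: mE; rewrite inE xs orbT.
apply/seteqP; split=> [w h|w [Ev h] x].
  by split=> [|x xs]; apply: h; rewrite inE ?eqxx ?xs ?orbT.
by rewrite inE => /predU1P[->//|]; exact: h.
Qed.

Lemma measure_le_sum (S : eqType) (s : seq S) (E : S -> set Omega) (A : set Omega) :
  measurable A -> (forall v, v \in s -> measurable (E v)) ->
  (forall w, A w -> exists2 v, v \in s & E v w) ->
  (P A <= \sum_(v <- s) P (E v))%E.
Proof.
elim: s A => [|v s IH] A mA mE cov.
  rewrite big_nil (_ : A = set0) ?measure0 //.
  by apply/seteqP; split=> // w /cov[].
have mv : measurable (E v) by apply: mE; rewrite mem_head.
rewrite big_cons -(setUIDK A (E v)).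
apply: le_trans (measureU2 _ _ _) _; [exact: measurableI|exact: measurableD|].
apply: leeD.
  by apply: le_measure; rewrite ?inE; [exact: measurableI|exact: mv|move=> w []].
apply: IH => [|x xs|w [Aw Ew]]; first exact: measurableD.
  by apply: mE; rewrite inE xs orbT.
have [x] := cov w Aw; rewrite inE => /predU1P[->//|xs Exw].
by exists x.
Qed.

(** The sum of the probabilities is the expectation of the number of events that occur, which is at
    most c on G and 0 elsewhere. *)
Lemma measure_sum_le_card (S : finType) (E : S -> set Omega) (G : set Omega) (c : R) :
  (forall s, measurable (E s)) -> measurable G -> (forall s, E s `<=` G) -> 0 <= c ->
  (forall w, G w -> #|[set s | w \in E s]%SET|%:R <= c) ->
  (\sum_s P (E s) <= c%:E * P G)%E.
Proof.
move=> mE mG EG c0 hc.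
have mI (A : set Omega) : measurable A -> measurable_fun setT (fun w => ((\1_A w)%:E : \bar R)).
  by move=> mA; apply/measurable_EFinP; exact: measurable_indic.
have I_ A : measurable A -> P A = (\int[P]_w (\1_A w)%:E)%E.
  by move=> mA; rewrite integral_indic // setIT.
rewrite (eq_bigr _ (fun s _ => I_ _ (mE s))) I_ //.
rewrite -ge0_integralZl //; last exact: mI.
rewrite -ge0_integral_sum //; last by move=> s; exact: mI.
apply: ge0_le_integral => //.
- by move=> w _; apply: sume_ge0 => s _; rewrite lee_fin indicE.
- by apply: emeasurable_sum => s; exact: mI.
- by apply: emeasurable_funM => //; exact: mI.
move=> w _; rewrite sumEFin -EFinM lee_fin.
have -> : \sum_s \1_(E s) w = #|[set s | w \in E s]%SET|%:R :> R.
  under eq_bigr do rewrite indicE.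
  rewrite -sum1_card natr_sum big_mkcond [RHS]big_mkcond /=.
  by apply: eq_bigr => s _; rewrite inE; case: ifP => //.
rewrite indicE; case: (boolP (w \in G)) => [|wG].
  by rewrite inE mulr1; exact: hc.
rewrite mulr0 eq_card0 // => s; rewrite !inE; apply/negbTE; apply: contra wG.
by rewrite !inE => /EG.
Qed.

End countable_partitions.

(** * Measurability of the lattice events *)

Section complex_measurability.
Variables (R : realType) (dT : measure_display) (T : measurableType dT).

Definition cmeas (F : T -> R[i]) :=
  measurable_fun setT (fun x => complex.Re (F x)) /\
  measurable_fun setT (fun x => complex.Im (F x)).

Lemma cmeas_cst (c : R[i]) : cmeas (fun=> c).
Proof. by split; exact: measurable_cst. Qed.

Lemma cmeasD F G : cmeas F -> cmeas G -> cmeas (fun x => F x + G x).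
Proof.
move=> [F1 F2] [G1 G2]; split.
  by rewrite (_ : (fun x => _) = (fun x => complex.Re (F x) + complex.Re (G x)));
    [exact: measurable_funD|apply/funext => x; case: (F x) (G x) => [? ?] [? ?]].
by rewrite (_ : (fun x => _) = (fun x => complex.Im (F x) + complex.Im (G x)));
  [exact: measurable_funD|apply/funext => x; case: (F x) (G x) => [? ?] [? ?]].
Qed.

Lemma cmeasM F G : cmeas F -> cmeas G -> cmeas (fun x => F x * G x).
Proof.
move=> [F1 F2] [G1 G2]; split.
  rewrite (_ : (fun x => _) = (fun x => complex.Re (F x) * complex.Re (G x)
      - complex.Im (F x) * complex.Im (G x))).
    by apply: measurable_funB; exact: measurable_funM.
  by apply/funext => x; case: (F x) (G x) => [? ?] [? ?].
rewrite (_ : (fun x => _) = (fun x => complex.Re (F x) * complex.Im (G x)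
    + complex.Im (F x) * complex.Re (G x))).
  by apply: measurable_funD; exact: measurable_funM.
by apply/funext => x; case: (F x) (G x) => [? ?] [? ?].
Qed.

Lemma cmeas_conj F : cmeas F -> cmeas (fun x => (F x)^*).
Proof.
move=> [F1 F2]; split.
  by rewrite (_ : (fun x => _) = (fun x => complex.Re (F x))) //;
    apply/funext => x; rewrite conjcE; case: (F x).
rewrite (_ : (fun x => _) = (fun x => - complex.Im (F x))); first exact: measurable_funN.
by apply/funext => x; rewrite conjcE; case: (F x).
Qed.

Lemma cmeas_sum (I : Type) (s : seq I) (F : I -> T -> R[i]) :
  (forall i, cmeas (F i)) -> cmeas (fun x => \sum_(i <- s) F i x).
Proof.
move=> mF; elim: s => [|i s IH].
  by under eq_fun do rewrite big_nil; exact: cmeas_cst.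
by under eq_fun do rewrite big_cons; exact: cmeasD.
Qed.

Lemma measurable_cmeas_eq F (c : R[i]) : cmeas F -> measurable [set x | F x = c].
Proof.
move=> [F1 F2].
rewrite (_ : [set x | _] = (fun x => complex.Re (F x)) @^-1` [set complex.Re c]
    `&` (fun x => complex.Im (F x)) @^-1` [set complex.Im c]).
  apply: measurableI; rewrite -[X in measurable X]setTI.
    by apply: F1 => //; exact: measurable_set1.
  by apply: F2 => //; exact: measurable_set1.
apply/seteqP; split=> x /=; first by move=> ->.
by case: (F x) c => [? ?] [? ?] /= [-> ->].
Qed.

Definition mxmeas m n (A : T -> 'M[R[i]]_(m, n)) := forall i j, cmeas (fun x => A x i j).

Lemma mxmeasX n (A : T -> 'M[R[i]]_n) k : mxmeas A -> mxmeas (fun x => A x ^+ k).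
Proof.
move=> mA; elim: k => [|k IH] i j; first by under eq_fun do rewrite expr0; exact: cmeas_cst.
under eq_fun do rewrite exprS -mulmxE mxE.
by apply: cmeas_sum => l; exact: cmeasM.
Qed.

Lemma cmeas_tr n (A : T -> 'M[R[i]]_n) : mxmeas A -> cmeas (fun x => \tr (A x)).
Proof. by move=> mA; apply: cmeas_sum => i; exact: mA. Qed.

Lemma measurable_damped_trace N M k (s : seq 'I_M) (v : T -> 'I_M -> 'cV[R[i]]_N) :
  (forall i, mxmeas (fun x => v x i)) ->
  measurable_fun setT (fun x => damped_trace (v x) k s).
Proof.
move=> mv; apply: (proj1 (cmeas_tr _)); apply: mxmeasX => i j.
under eq_fun do rewrite /damped /gram !mxE summxE.
apply: cmeasD; first exact: cmeas_cst.
rewrite (_ : (fun x => _) = (fun x => -1 *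
   ((N%:R * (2 ^ k)%:R)^-1 * \sum_(l <- s) (v x l i 0 * (v x l j 0)^*)))).
  apply: cmeasM; first exact: cmeas_cst.
  apply: cmeasM; first exact: cmeas_cst.
  by apply: cmeas_sum => l; apply: cmeasM; [exact: mv|apply: cmeas_conj; exact: mv].
apply/funext => x; rewrite mulN1r; congr (- (_ * _)).
by apply: eq_bigr => l _; rewrite outerE.
Qed.

End complex_measurability.

Section lattice_measurability.
Variables (R : realType) (m : nat).

Lemma measurable_rmod (b : R) : measurable_fun setT (fun a : R => rmod a b).
Proof.
rewrite /rmod; apply: measurable_funB => //; apply: measurable_funM => //.
have mf : measurable_fun setT (fun a : R => (Num.floor a)%:~R : R).
  by apply: nondecreasing_measurable => // a a' aa'; rewrite ler_int; exact: le_floor.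
by apply: (measurableT_comp mf); exact: measurable_funM.
Qed.

Lemma measurable_lattice_pt M i : measurable_fun setT (fun z : m.-tuple R => lattice_pt M z i).
Proof.
apply/measurable_fun_tnthP => j.
rewrite (_ : _ \o _ = fun z : m.-tuple R => M%:R^-1 * rmod (i%:R * tnth z j) M%:R).
  apply: measurable_funM => //; apply: (measurableT_comp (measurable_rmod _)).
  by apply: measurable_funM => //; exact: measurable_tnth.
by apply/funext => z /=; rewrite tnth_mktuple.
Qed.

Lemma cmeas_expchar_lattice (k : m.-tuple int) M i :
  cmeas (fun z : m.-tuple R => expchar k (lattice_pt M z i)).
Proof.
have mp := measurableT_comp (@measurable_phase R m k) (measurable_lattice_pt M i).
by split; [exact: (measurableT_comp (@measurable_cos R) mp)|
           exact: (measurableT_comp (@measurable_sin R) mp)].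
Qed.

Lemma measurable_reconstructing (J : {fset m.-tuple int}) M :
  measurable [set z : m.-tuple R | reconstructing J M z].
Proof.
rewrite (_ : [set z | _] = [set z | forall k, k \in enum_fset J ->
   [set z | forall l, l \in enum_fset J ->
     [set z | ((M%:R)^-1)%:C%C * (\sum_(i < M)
        expchar [tuple tnth k j - tnth l j | j < m] (lattice_pt M z i))
      = ([tuple tnth k j - tnth l j | j < m] == [tuple 0 | j < m])%:R] z] z]).
  apply: measurable_all_in => k _; apply: measurable_all_in => l _.
  apply: measurable_cmeas_eq; apply: cmeasM; first exact: cmeas_cst.
  by apply: cmeas_sum => i; exact: cmeas_expchar_lattice.
by apply/seteqP; split=> [z h k kJ l lJ|z h k l kJ lJ]; [exact: h|exact: (h k kJ l lJ)].
Qed.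

Lemma measurable_large_trace (J : {fset m.-tuple int}) M k (s : seq 'I_M) (tau : R) :
  measurable [set z : m.-tuple R | tau <= damped_trace (lattice_vec J z) k s].
Proof.
rewrite (_ : [set z | _] =
   (fun z => damped_trace (lattice_vec J z) k s) @^-1` `[tau, +oo[%classic).
  rewrite -[X in measurable X]setTI; apply: measurable_damped_trace => //.
  move=> i j l; rewrite /lattice_vec; under eq_fun do rewrite mxE.
  by apply: cmeas_conj; exact: cmeas_expchar_lattice.
by apply/seteqP; split=> z /=; rewrite in_itv /= andbT.
Qed.

End lattice_measurability.


(** * The failure probability of one step *)

Lemma ord_tuple_of_seq (M m : nat) (t : seq nat) :
  all (fun i => (i < M)%N) t -> size t = m ->
  exists s : m.-tuple 'I_M, map val s = t.
Proof.
move=> + <-; elim: t => [_|i t IH /= /andP[iM /IH[s sE]]]; first by exists [tuple].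
by exists [tuple of Ordinal iM :: s]; rewrite /= sE.
Qed.

Section one_step.
Variables (R : realType) (dOmega : measure_display).
Variables (Omega : measurableType dOmega) (P : probability Omega R).
Variables (d r : nat) (X : construction R Omega d r).
Variables (f : d.-tuple R -> R[i]) (eps delta : R) (u : {set 'I_d}).
Hypothesis rc : random_construction X.
Hypothesis us : u \in steps d.

Let mlat_size M : measurable [set w | lat_size X u w = M].
Proof. by case: (rc us). Qed.

Let mdraws s : measurable [set w | draws X u w = s].
Proof. by case: (rc us). Qed.

Lemma measurable_lattice_event M B : measurable B -> measurable (lattice_event X (u:=u) M B).
Proof.
move=> mB; apply: (@measurableI _ _ [set w | lat_size X u w = M] (lat_gen X u @^-1` B)) => //.
by have [_ mg _ _ _] := rc us; rewrite -[X in measurable X]setTI; exact: mg.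
Qed.

Lemma measurable_anchors_event C : (forall i, measurable (C i)) ->
  measurable (anchors_event X (u:=u) C).
Proof.
move=> mC; rewrite (_ : anchors_event X (u:=u) C =
   [set w | forall i, i \in enum 'I_r -> [set w | C i (anchor X u i w)] w]).
  apply: measurable_all_in => i _; have [_ _ _ ma _] := rc us.
  by rewrite -[X in measurable X]setTI; exact: ma.
by apply/seteqP; split=> w h i; [move=> _; exact: h|apply: h; rewrite mem_enum].
Qed.

Lemma measurable_history h : measurable (history X u h).
Proof.
apply: (@measurable_all_in _ _ _ _ (fun v => [set w | detected X v w = h v])) => v vu.
by have [] := rc (mem_take vu).
Qed.

Lemma measurable_detects : measurable (detects X f delta u).
Proof.
have md K : measurable [set w | detected X u w = K] by case: (rc us).
have := measurable_fiber_pred md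
  [set K : {fset _} | projection u (large_freqs delta f) `<=` [set` K]].
by move=> H; refine (eq_ind _ measurable H _ _); apply/seteqP; split.
Qed.

Lemma measurable_rec_event J :
  measurable [set w | reconstructing J (lat_size X u w) (lat_gen X u w)].
Proof.
rewrite (_ : [set w | _] = \bigcup_M lattice_event X (u:=u) M [set z | reconstructing J M z]).
  apply: bigcup_measurable => M _; apply: measurable_lattice_event.
  exact: measurable_reconstructing.
apply/seteqP; split=> [w rec|w [M _ [/= <-]]] //.
by exists (lat_size X u w).
Qed.

Hypothesis unif : uniform_draws P X u.
Hypothesis lat0 : forall w, (0 < lat_size X u w)%N.
Hypothesis drawsP : forall w, all (fun i => (i < lat_size X u w)%N) (draws X u w).

(** On each fiber of lattice size and draws, [uniform_draws] is used twice, with C and with the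
    whole space for every anchor; the two probabilities differ by the factor q^r. *)
Lemma anchors_event_le h (C : set (#|~: u|.-tuple R)) (q : R) :
  measurable C -> haar R #|~: u| C = q%:E -> 0 <= q ->
  (P (history X u h `&` anchors_event X (u:=u) (fun=> C)) <= (q ^+ r)%:E * P (history X u h))%E.
Proof.
move=> mC qE q0.
have mH := measurable_history h.
have mA : measurable (anchors_event X (u:=u) (fun=> C)) by apply: measurable_anchors_event.
pose g w := (lat_size X u w, draws X u w).
have gE w0 : [set w | g w = g w0] =
    [set w | lat_size X u w = lat_size X u w0] `&` [set w | draws X u w = draws X u w0].
  by apply/seteqP; split=> w /=; rewrite /g; [case|case=> -> ->].
have mg t : measurable [set w | g w = t].
  rewrite (_ : [set w | _] = [set w | lat_size X u w = t.1] `&` [set w | draws X u w = t.2]).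
    exact: measurableI.
  by apply/seteqP; split=> w /=; rewrite /g; [move=> <-|case: t => a b /= [-> ->]].
have q0r : 0 <= q ^+ r by exact: exprn_ge0.
have := @measure_le_fibers _ _ _ P _ g mg (history X u h `&` anchors_event X (u:=u) (fun=> C)) (history X u h) (q ^+ r) (measurableI _ _ mH mA) mH q0r. apply=> w0 _.
set M := lat_size X u w0; set s := draws X u w0.
have E (C' : 'I_r -> set (#|~: u|.-tuple R)) :
    history X u h `&` anchors_event X (u:=u) C' `&` [set w | g w = g w0] =
    history X u h `&` lattice_event X (u:=u) M setT `&` draws_event X u s
      `&` anchors_event X (u:=u) C'.
  rewrite gE; apply/seteqP; split=> w /=.
    by move=> [[H1 H2] [H3 H4]]; split=> //; split.
  by move=> [[[H1 [H2 _]] H3] H4]; split.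
have CT : anchors_event X (u:=u) (fun=> setT) = setT.
  by apply/seteqP; split.
rewrite E -[X in (_ <= _ * P (X `&` _))%E]setIT -CT E.
have pT : (\prod_(i < r) haar R #|~: u| setT = 1)%E.
  by apply: big1 => i _; exact: probability_setT.
have pC : (\prod_(i < r) haar R #|~: u| C = (q ^+ r)%:E)%E.
  by rewrite (eq_bigr (fun=> q%:E)) // prodEFin prodr_const card_ord.
by rewrite !unif ?drawsP // pT pC mule1 muleC.
Qed.

(** On a fiber of lattice size M and number m of draws, each list of indices has conditional weight
    M^-m, while for every reconstructing lattice [card_large_trace_le] allows at most 3/4 eps M^m
    bad lists. *)
Lemma bad_draws_le h (J : {fset #|u|.-tuple int}) (A : set Omega) :
  0 < eps -> (0 < size J)%N ->
  measurable A -> A `<=` history X u h ->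
  (forall w, A w -> reconstructing J (lat_size X u w) (lat_gen X u w)) ->
  (forall w, A w -> (size J)%:R *
     expR (- (3 / 16 * ((size (draws X u w))%:R / (size J)%:R))) <= eps / 2) ->
  (forall w, A w -> ~ forall c, (size (samples X u w))%:R / 4 * (\sum_(l <- J) normc (c l) ^+ 2)
     <= \sum_(x <- samples X u w) normc (trig_poly J c x) ^+ 2) ->
  (P A <= (3 / 4 * eps)%:E * P (history X u h))%E.
Proof.
move=> eps0 J0 mA AH Arec Aenough Abad.
have mH := measurable_history h.
pose g w := (lat_size X u w, size (draws X u w)).
have msz m : measurable [set w | size (draws X u w) = m].
  exact: (measurable_fiber_pred mdraws [set s | size s = m]).
have gE w0 : [set w | g w = g w0] = [set w | lat_size X u w = lat_size X u w0]
    `&` [set w | size (draws X u w) = size (draws X u w0)].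
  by apply/seteqP; split=> w /=; rewrite /g; [case|case=> -> ->].
have mg t : measurable [set w | g w = t].
  rewrite (_ : [set w | _] = [set w | lat_size X u w = t.1]
     `&` [set w | size (draws X u w) = t.2]); first exact: measurableI.
  by apply/seteqP; split=> w /=; rewrite /g; [move=> <-|case: t => a b /= [-> ->]].
have c0 : 0 <= 3 / 4 * eps by rewrite mulr_ge0 // ltW.
have := @measure_le_fibers _ _ _ P _ g mg A (history X u h) _ mA mH c0; apply=> w0 Aw0.
set M := lat_size X u w0; set m := size (draws X u w0).
have [k [k0 mK card_le]] := card_large_trace_le J0 eps0 (Aenough _ Aw0).
rewrite -/m in mK card_le.
set tau := (1 - m%:R / (4 * ((size J)%:R * (2 ^ k)%:R))) ^+ (2 ^ k) in card_le.
(* The roles are exchanged: the list s is fixed and B s collects the generators for which s is bad,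
   which is the form of event that [uniform_draws] factors. *)
pose B (s : m.-tuple 'I_M) : set (#|u|.-tuple R) := [set z | reconstructing J M z]
   `&` [set z | tau <= damped_trace (lattice_vec J z) k s].
have mB s : measurable (B s).
  by apply: measurableI; [exact: measurable_reconstructing|exact: measurable_large_trace].
pose F (s : m.-tuple 'I_M) := history X u h `&` lattice_event X M (B s)
   `&` draws_event X u (map val s).
pose E (s : m.-tuple 'I_M) := history X u h `&` lattice_event X M (B s)
   `&` [set w | size (draws X u w) = m].
have mF s : measurable (F s).
  apply: measurableI; last exact: mdraws.
  by apply: measurableI => //; exact: measurable_lattice_event.
have mE s : measurable (E s).
  apply: measurableI; last exact: msz.
  by apply: measurableI => //; exact: measurable_lattice_event.
have FE s : P (F s) = (P (E s) * ((M%:R)^-1 ^+ m)%:E)%E.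
  have all_lt : all (fun i => (i < M)%N) (map val s).
    by apply/allP => _ /mapP[i _ ->]; exact: ltn_ord.
  have := unif h (mB s) all_lt (fun=> @measurableT _ _).
  rewrite size_map size_tuple big1 ?mule1 => [<-|i _]; last exact: probability_setT.
  by congr (P _); apply/seteqP; split=> w; [split|case].
apply: (@le_trans _ _ (\sum_(s : m.-tuple 'I_M) P (F s))%E).
  apply: measure_le_sum => //; first exact: measurableI.
  move=> w [Aw]; rewrite gE => -[/= wM wm].
  have drw : all (fun i => (i < M)%N) (draws X u w) by rewrite /M -wM; exact: drawsP.
  have [s sE] := ord_tuple_of_seq drw wm.
  exists s; first by rewrite mem_index_enum.
  split; last by rewrite /draws_event /= sE.
  split; first exact: AH.
  split=> //; split; first by rewrite /= /M -wM; exact: Arec.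
  rewrite /= leNgt; apply/negP => small; apply: (Abad _ Aw) => c.
  have := @lattice_coercive _ _ J M (lat_gen X u w) k s J0 k0.
  rewrite size_tuple => /(_ mK small c).
  rewrite /samples wM -sE -map_comp size_map size_tuple; exact.
rewrite (eq_bigr _ (fun s _ => FE s)) -ge0_sume_distrl; last first.
  by move=> s _; exact: measure_ge0.
have M0 : (0 < M)%N by exact: lat0.
have MR : 0 < M%:R ^+ m :> R by rewrite exprn_gt0 // ltr0n.
(* E s no longer fixes the draws, only their number, so summing over s counts for each outcome the
   lists that are bad for its lattice. *)
have le1 : (\sum_(s : m.-tuple 'I_M) P (E s)
    <= (3 / 4 * eps * M%:R ^+ m)%:E * P (history X u h `&` [set w | g w = g w0]))%E.
  apply: measure_sum_le_card => //.
  - exact: measurableI.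
  - by move=> s w [[Hw [/= wM _]] /= wm]; split=> //=; rewrite /g wM wm.
  - by rewrite mulr_ge0 // ltW.
  move=> w [Hw /= [wM wm]].
  have [rec|nrec] := pselect (reconstructing J M (lat_gen X u w)); last first.
    rewrite eq_card0 ?mulr_ge0 // ?ltW // => s; rewrite !inE; apply/negbTE/negP.
    by rewrite inE => -[[_ [_ []]]].
  apply: le_trans (card_le M _ (lattice_vec_norm (lat_gen X u w))
    (sum_outer_lattice_vec M0 rec)).
  rewrite ler_nat; apply: subset_leq_card; apply/fintype.subsetP => s.
  by rewrite !inE => -[[_ [_ []]]].
apply: (@le_trans _ _ ((3 / 4 * eps * M%:R ^+ m)%:E
   * P (history X u h `&` [set w | g w = g w0]) * ((M%:R)^-1 ^+ m)%:E)%E).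
  by rewrite lee_wpmul2r // lee_fin exprn_ge0 // invr_ge0.
by rewrite muleAC -EFinM exprVn mulfK // lt0r_neq0.
Qed.

End one_step.


(** * Detection from coercivity and good anchors *)

Section detection.
Variables (R : realType) (dOmega : measure_display).
Variables (Omega : measurableType dOmega) (P : probability Omega R).
Variables (d r : nat) (X : construction R Omega d r).
Variables (f : d.-tuple R -> R[i]) (eps delta : R) (u : {set 'I_d}).
Local Notation I := (large_freqs delta f).

(** An infinite sup norm would force the real threshold below -oo. The L2 term is subtracted and
    nonnegative, so the bound survives without it. *)
Lemma threshold_supnorm w : admissible_threshold X f delta u ->
  exists e : R, [/\ 0 <= e,
    forall x, normc (f x - fourier_proj (cylinder (candidates X u w)) f x) <= e &
    threshold X u w <= delta / Num.sqrt 2 - 2 * e].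
Proof.
move=> /(_ w) /=; set E2 := L2norm _; set Einf := supnorm _ => h.
have E20 : (0 <= E2)%E by exact: Lnorm_ge0.
have supE x : ((normc (f x - fourier_proj (cylinder (candidates X u w)) f x))%:E <= Einf)%E.
  by apply: ereal_sup_ubound; exists x.
have Einf0 : (0 <= Einf)%E.
  by apply: le_trans (supE [tuple 0 | j < d]); rewrite lee_fin normc_ge0.
have E20' : (0 <= 4%:E * E2)%E by rewrite mule_ge0.
move: h supE Einf0; case: Einf => [e| |//] h supE.
  rewrite lee_fin => e0; exists e; split=> //.
  rewrite -lee_fin; apply: le_trans h _; rewrite EFinB EFinM leeB //.
  by rewrite -[leRHS]adde0 leeD2l // leeNl oppe0.
by move: h; rewrite gt0_muley ?lte_fin // addeNy leeNy_eq.
Qed.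

Hypothesis delta0 : 0 < delta.

(** At a good anchor the truncated coefficient is at least delta / sqrt 2 + 4 eta. Least squares
    errs by at most 2 (e + 2 eta), where e is the sup norm distance of f to its projection and 2 eta
    comes from truncation; what remains is delta / sqrt 2 - 2 e, which is at least the threshold. *)
Lemma detects_of_coercive (G : {fset d.-tuple int}) (eta : R) w :
  0 < eta ->
  (forall (L : set (d.-tuple int)) x,
     normc (fourier_proj L f x - \sum_(l <- G | l \in L) fourier_coef f l * expchar l x)
       <= 2 * eta) ->
  (forall i, least_squares (candidates X u w) (samples X u w)
     (fun x => f (merge_pt u x (anchor X u i w))) (coefs X u i w)) ->
  thresholded X u -> admissible_threshold X f delta u ->
  (0 < size (draws X u w))%N ->
  projection u I `<=` [set` candidates X u w] ->
  (forall c, (size (samples X u w))%:R / 4 *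
      (\sum_(l <- candidates X u w) normc (c l) ^+ 2)
     <= \sum_(x <- samples X u w) normc (trig_poly (candidates X u w) c x) ^+ 2) ->
  (forall k, projection u I k -> exists i : 'I_r,
     delta / Num.sqrt 2 + 4 * eta <= normc (partial_coef f G k (anchor X u i w))) ->
  detects X f delta u w.
Proof.
move=> eta0 approx ls thr adm sz IJ coer anch k kI.
have kJ := IJ _ kI; have [i hi] := anch _ kI.
have [e [e0 he hthr]] := threshold_supnorm w adm.
rewrite /= thr [_ \in _]kJ /=.
apply: (@le_trans _ _ (normc (coefs X u i w k))); last exact: le_bigmax.
have Ee0 : 0 <= e + 2 * eta by rewrite addr_ge0 // mulr_ge0 // ltW.
have close (x : #|u|.-tuple R) : normc (trig_poly (candidates X u w)
    (partial_coef f G ^~ (anchor X u i w)) x - f (merge_pt u x (anchor X u i w)))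
    <= e + 2 * eta.
  rewrite sum_partial_coef; set y := merge_pt _ _ _.
  have := approx (cylinder (candidates X u w)) y.
  have -> : \sum_(l <- G | l \in cylinder (candidates X u w)) fourier_coef f l * expchar l y
    = \sum_(l <- G | freq_proj u l \in candidates X u w) fourier_coef f l * expchar l y.
    by apply: eq_bigl => l; apply/idP/idP; rewrite inE.
  set S := \sum_(l <- G | _) _; set Q := fourier_proj _ _ _ => h.
  have -> : S - f y = - ((f y - Q) + (Q - S)) by rewrite addrA subrK opprB.
  rewrite normcN; apply: le_trans (le_normcD _ _) _; apply: lerD; [exact: (he y)|exact: h].
have sz' : (0 < size (samples X u w))%N by rewrite size_map.
have := least_squares_coef coer sz' Ee0 (ls i) close kJ.
set a := normc (_ - _) => ha.
have tri : normc (partial_coef f G k (anchor X u i w)) <= normc (coefs X u i w k) + a.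
  rewrite /a -[X in _ <= _ + X]normcN opprB; apply: le_trans _ (le_normcD _ _).
  by rewrite addrC subrK.
move: hi ha tri hthr.
move: (normc (partial_coef _ _ _ _)) (normc (coefs _ _ _ _ _)) a (delta / _) => p q a' c.
by move: (threshold X u w) => t; lra.
Qed.

End detection.

Lemma enough_draws_expR (R : realType) (eps : R) (N m r : nat) :
  0 < eps -> eps < 1 -> (0 < r)%N -> (0 < N)%N ->
  12 * N%:R * (ln N%:R + ln (2 * r%:R / eps)) <= m%:R :> R ->
  (0 < m)%N /\ N%:R * expR (- (3 / 16 * (m%:R / N%:R))) <= eps / 2.
Proof.
move=> eps0 e1 r0 N0 h; have NR : 0 < N%:R :> R by rewrite ltr0n.
have N1 : 1 <= N%:R :> R by rewrite ler1n.
have rR : 1 <= r%:R :> R by rewrite ler1n.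
have y1 : 1 < 2 * r%:R / eps.
  by rewrite ltr_pdivlMr // mul1r; apply: lt_le_trans e1 _; move: rR; lra.
have y0 : 0 < 2 * r%:R / eps by apply: lt_trans y1.
have L0 : 0 < ln N%:R + ln (2 * r%:R / eps) by rewrite ltr_wpDl ?ln_ge0 // ln_gt0.
split; first by rewrite -(ltr0n R); apply: lt_le_trans h; rewrite !mulr_gt0.
have h2 : ln N%:R + ln (2 * r%:R / eps) <= 3 / 16 * (m%:R / N%:R).
  (* Here 12 * 3/16 = 9/4 is at least 1, and the logarithms are nonnegative in sum. *)
  apply: (@le_trans _ _ (3 / 16 * (12 * (ln N%:R + ln (2 * r%:R / eps))))).
    by move: (ln N%:R + _) L0 => L; lra.
  rewrite ler_pM2l // ler_pdivlMr //; apply: le_trans h.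
  by rewrite le_eqVlt; apply/orP; left; apply/eqP; ring.
apply: (@le_trans _ _ (N%:R * expR (- (ln N%:R + ln (2 * r%:R / eps))))).
  by rewrite ler_pM2l // ler_expR lerN2.
rewrite opprD expRD !expRN !lnK ?posrE // mulrA mulfV ?mul1r ?lt0r_neq0 //.
rewrite invf_div ler_pdivrMr; last by rewrite mulr_gt0 // (lt_le_trans ltr01).
have -> : eps / 2 * (2 * r%:R) = eps * r%:R by field.
by rewrite ler_peMr // ltW.
Qed.

Section step_failure.
Variables (R : realType) (dOmega : measure_display).
Variables (Omega : measurableType dOmega) (P : probability Omega R).
Variables (d r : nat) (X : construction R Omega d r).
Variables (f : d.-tuple R -> R[i]) (eps delta : R) (u : {set 'I_d}).
Local Notation I := (large_freqs delta f).
Hypotheses (eps0 : 0 < eps) (delta0 : 0 < delta) (r0 : (0 < r)%N).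
Hypothesis Ifin : finite_set I.
Hypothesis anchors : enough_anchors f eps delta r.
Hypothesis rc : random_construction X.
Hypothesis us : u \in steps d.


(* 23 / 8 = 1 + 3 / 4 + 9 / 8: the lattice, the draws and the anchors. *)
Lemma step_failure_le h (J : {fset #|u|.-tuple int}) :
  valid_step P X f eps delta u ->
  (forall w, history X u h w -> candidates X u w = J) ->
  projection u I `<=` [set` J] ->
  (P (history X u h `&` ~` detects X f delta u)
     <= (23 / 8 * eps)%:E * P (history X u h))%E.
Proof.
move=> [[lat0 drawsP rec unif _] enough ls thr adm] candJ IJ.
have mH := measurable_history u rc h.
have mD := measurable_detects f delta rc us.
have mA0 : measurable (history X u h `&` ~` detects X f delta u).
  by apply: measurableI => //; exact: measurableC.
(* For eps >= 1 the bound exceeds the probability of the history; below, eps < 1 makes log (1 / eps)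
   positive. *)
have [eps1|eps1] := leP 1 eps.
  apply: (@le_trans _ _ (P (history X u h))).
    by apply: le_measure; rewrite ?inE // => w [].
  rewrite -[leLHS]mul1e lee_wpmul2r // lee_fin.
  by apply: le_trans eps1 _; rewrite ler_peMl ?(ltW eps0) //; lra.
(* With no large frequency there is nothing to detect; this also disposes of log 0. *)
have [I0|/fset0Pn[l0 l0I]] := eqVneq (fset_set I) fset0.
  rewrite (_ : _ `&` _ = set0) ?measure0.
    by rewrite mule_ge0 // lee_fin mulr_ge0 // ltW.
  apply/seteqP; split=> // w [_]; apply => k [l lI _].
  have : l \in fset_set I by rewrite in_fset_set // inE.
  by rewrite I0.
have n0 : (0 < #|` fset_set I|)%N by rewrite cardfs_gt0; apply/fset0Pn; exists l0.
have nR : 0 < #|` fset_set I|%:R :> R by rewrite ltr0n.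
have [eta [G [eta0 approx miss]]] := detection_scale eps0 eps1 delta0 r0 Ifin n0 anchors.
set t := delta / Num.sqrt 2 + 4 * eta in miss.
have t0 : 0 <= t by rewrite addr_ge0 ?divr_ge0 ?sqrtr_ge0 ?mulr_ge0 // ltW.
have J0 : (0 < size J)%N.
  rewrite -[size J]/(#|` J|) cardfs_gt0; apply/fset0Pn; exists (freq_proj u l0).
  by apply: IJ; exists l0 => //; move: l0I; rewrite in_fset_set // inE.
pose C k : set (#|~: u|.-tuple R) := [set xi | normc (partial_coef f G k xi) < t].
have mC k : measurable (C k).
  rewrite /C; under eq_set do rewrite partial_coef_trig_poly.
  exact: measurable_trig_poly_small.
pose K := [fset freq_proj u l | l in fset_set I]%fset.
have KP k : k \in K -> projection u I k.
  by move=> /imfsetP[l /= lI ->]; exists l => //; move: lI; rewrite in_fset_set // inE.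
have PK k : projection u I k -> k \in K.
  by move=> [l lI <-]; apply/imfsetP; exists l => //=; rewrite in_fset_set // inE.
pose E := [set w | reconstructing J (lat_size X u w) (lat_gen X u w)].
have mE : measurable E by exact: measurable_rec_event.
pose AK k := history X u h `&` anchors_event X (u:=u) (fun=> C k).
have mAK k : measurable (AK k).
  by apply: measurableI => //; apply: measurable_anchors_event.
pose U := \bigcup_(k in [set` K]) AK k.
have mU : measurable U by apply: fin_bigcup_measurable.
have PHE : (P (history X u h `&` ~` E) <= eps%:E * P (history X u h))%E.
  have HE : P (history X u h `&` [set w | reconstructing (candidates X u w)
      (lat_size X u w) (lat_gen X u w)]) = P (history X u h `&` E).
    by congr (P _); apply/seteqP; split=> w [Hw] /=; rewrite (candJ w Hw).
  have := rec h; rewrite HE.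
  have -> : P (history X u h) = (P (history X u h `&` E) + P (history X u h `&` ~` E))%E.
    rewrite -measureU; first by rewrite -setIUr setUv setIT.
    - exact: measurableI.
    - by apply: measurableI => //; exact: measurableC.
    - by rewrite setIACA setICr setI0.
  have fin B : measurable B -> P B \is a fin_num by move=> ?; exact: fin_num_measure.
  rewrite -(fineK (fin _ (measurableI _ _ mH mE))).
  rewrite -(fineK (fin _ (measurableI _ _ mH (measurableC mE)))).
  rewrite -!EFinD -!EFinM !lee_fin.
  by move: (fine _) (fine _) => x y; lra.
have PU : (P U <= (9 / 8 * eps)%:E * P (history X u h))%E.
  apply: (@le_trans _ _ (\sum_(k <- enum_fset K) P (AK k))%E).
    by apply: measure_le_sum => // w [k kK AKw]; exists k.
  apply: (@le_trans _ _ (\sum_(k <- enum_fset K)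
     ((9 / 8 * eps / #|` fset_set I|%:R)%:E * P (history X u h)))%E).
    (* Each projected frequency is missed by all r anchors with probability at most 9/8 eps /
       |I_delta|, and there are at most |I_delta| of them. *)
    rewrite big_seq [leRHS]big_seq; apply: lee_sum => k kK.
    have [q [qE q0 nq]] := miss u k (KP _ kK).
    have ale := anchors_event_le rc us unif drawsP h (mC k) qE q0.
    apply: (le_trans ale).
    by rewrite lee_wpmul2r // lee_fin ler_pdivlMr // mulrC.
  rewrite -ge0_sume_distrl; last by move=> k _; rewrite lee_fin divr_ge0 ?mulr_ge0 // ltW.
  rewrite sumEFin lee_wpmul2r // lee_fin big_const_seq count_predT iter_addr_0.
  rewrite -[leLHS]mulr_natr [leLHS]mulrAC ler_pdivrMr // ler_wpM2l ?mulr_ge0 ?(ltW eps0) //.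
  rewrite ler_nat; exact: leq_imfset_card.
(* Failure although the lattice and the anchors are good: by [detects_of_coercive] the draws must
   then violate coercivity. *)
pose A1 := history X u h `&` ~` detects X f delta u `&` E `&` ~` U.
have mA1 : measurable A1.
  by apply: measurableI; [exact: measurableI|exact: measurableC].
have PA1 : (P A1 <= (3 / 4 * eps)%:E * P (history X u h))%E.
  have cJ w : A1 w -> candidates X u w = J by move=> [[[Hw _] _] _]; exact: candJ.
  have en w : A1 w -> (0 < size (draws X u w))%N /\ (size J)%:R *
      expR (- (3 / 16 * ((size (draws X u w))%:R / (size J)%:R))) <= eps / 2.
    move=> A1w; apply: (enough_draws_expR eps0 eps1 r0 J0).
    by have := enough w; rewrite /= (cJ w A1w).
  apply: (@bad_draws_le _ _ _ _ _ _ _ _ _ rc us unif lat0 drawsP h J) => //.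
  - by move=> w [[[Hw _] _] _].
  - by move=> w [[_ Ew] _].
  - by move=> w /en[].
  move=> w A1w coer; have [[[Hw nd] Ew] nU] := A1w; apply: nd.
  have dc := detects_of_coercive eta0 approx (ls w) thr adm.
  rewrite (cJ _ A1w) in dc; apply: dc => //.
    by case: (en w A1w).
  move=> k kI; apply: contrapT => no; apply: nU; exists k; first exact: PK.
  split=> // i; rewrite /C /= ltNge; apply/negP => le_; apply: no; by exists i.
apply: (@le_trans _ _ (P ((history X u h `&` ~` E) `|` (A1 `|` U)))).
  apply: le_measure; rewrite ?inE //.
    apply: measurableU; last exact: measurableU.
    by apply: measurableI => //; exact: measurableC.
  move=> w [Hw nd]; have [Ew|nE] := pselect (E w); last by left.
  by right; have [Uw|nU] := pselect (U w); [right|left].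
apply: le_trans (measureU2 _ _ _) _.
- by apply: measurableI => //; exact: measurableC.
- exact: measurableU.
have -> : (23 / 8 * eps)%:E = (eps%:E + ((3 / 4 * eps)%:E + (9 / 8 * eps)%:E))%E.
  by rewrite -!EFinD; congr (_%:E); field.
have e34 : (0 <= (3 / 4 * eps)%:E)%E by rewrite lee_fin mulr_ge0 // ltW.
have e98 : (0 <= (9 / 8 * eps)%:E)%E by rewrite lee_fin mulr_ge0 // ltW.
have e1 : (0 <= eps%:E)%E by rewrite lee_fin ltW.
rewrite (ge0_muleDl _ e1 (adde_ge0 e34 e98)) (ge0_muleDl _ e34 e98).
apply: leeD => //.
by apply: le_trans (measureU2 _ _ _) _ => //; exact: leeD.
Qed.

End step_failure.


(** * The order of the steps *)

Section step_order.
Variable d : nat.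
Implicit Types t : 'I_d.

Lemma card_seg n : (n <= d)%N -> #|seg d n| = n.
Proof.
move=> nd; have winj : injective (widen_ord nd) by move=> i j /(congr1 val) /= /val_inj.
rewrite -[RHS]card_ord -(card_imset predT winj).
apply: eq_card => j; rewrite !inE; apply/idP/imsetP => [jn|[i _ ->] //=].
by exists (Ordinal jn) => //; apply: val_inj.
Qed.

Lemma seg1 t : t = 0%N :> nat -> seg d 1 = [set t]%SET.
Proof.
by move=> t0; apply/setP => j; rewrite !inE ltnS leqn0 -(inj_eq val_inj) /= t0.
Qed.

Lemma set1_in_steps t : [set t]%SET \in steps d.
Proof. by rewrite mem_cat map_f ?mem_enum. Qed.

Lemma seg_in_steps t : seg d t.+1 \in steps d.
Proof.
have [t0|t0] := posnP t; first by rewrite t0 (seg1 t0) set1_in_steps.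
by rewrite mem_cat [X in _ || X]map_f ?orbT // mem_filter t0 mem_enum.
Qed.

(** This is why a history determines the candidates of a step of part 2: both sets they are built
    from have been detected before. *)
Lemma earlier_seg t : (0 < t)%N ->
  [set t]%SET \in earlier (seg d t.+1) /\ seg d t \in earlier (seg d t.+1).
Proof.
(* Having t + 1 > 1 elements, [seg d t.+1] is not a singleton, so its index lies in the second
   block. *)
move=> t0; rewrite /earlier /steps index_cat ifN; last first.
  apply/negP => /mapP[t' _ E]; have := card_seg (ltn_ord t).
  by rewrite E cards1 => -[t00]; rewrite -t00 in t0.
rewrite take_cat ltnNge leq_addr /= addKn !mem_cat.
split; first by rewrite map_f ?mem_enum.
have pd : (t.-1 < d)%N by apply: leq_ltn_trans (ltn_ord t); exact: leq_pred.
pose p : 'I_d := Ordinal pd.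
have tE : t = p.+1 :> nat by rewrite /= prednK.
(* The second block has no entry for index 0: if t = 1, then [seg d t] is a singleton of the first
   block, otherwise it precedes [seg d t.+1] in the second. *)
have [p0|p0] := posnP p.
  by rewrite tE p0 (seg1 p0) map_f ?mem_enum.
apply/orP; right; rewrite [X in seg d X]tE.
set s := [seq t : 'I_d <- enum 'I_d | (0 < t)%N].
have ps : p \in s by rewrite mem_filter p0 mem_enum.
have ts : t \in s by rewrite mem_filter t0 mem_enum.
have inj : injective (fun t : 'I_d => seg d t.+1).
  move=> a b E; apply: val_inj; apply: succn_inj.
  by rewrite -(card_seg (ltn_ord a)) E card_seg.
rewrite in_take ?(map_f (fun t : 'I_d => seg d t.+1)) //.
rewrite -/(seg d p.+1) !(index_map inj).
have srt : sorted (fun a b : 'I_d => (a < b)%N) s.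
  apply: sorted_filter; first by move=> x y z; exact: ltn_trans.
  by have := iota_ltn_sorted 0 d; rewrite -val_enum_ord sorted_map.
rewrite ltnNge leq_eqVlt; apply/negP => /orP[/eqP E|lt].
  have : t = p by rewrite -(nth_index t ts) -(nth_index t ps) E.
  by move/(congr1 val) => /=; rewrite tE => /eqP; rewrite -[X in _ == X]/(p : nat) gtn_eqF.
have tr : transitive (fun a b : 'I_d => (a < b)%N) by move=> x y z; exact: ltn_trans.
have := sorted_ltn_index tr srt t p ts ps lt.
by rewrite [X in (X < _)%N]tE ltnNge leqnSn.
Qed.

Lemma restrict_freq_proj (u v : {set 'I_d}) (l : d.-tuple int) : v \subset u ->
  restrict_freq u v (freq_proj u l) = freq_proj v l.
Proof.
move=> vu; apply: eq_from_tnth => i; rewrite !tnth_mktuple.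
have iu : enum_val i \in u by apply: (fintype.subsetP vu); exact: enum_valP.
by rewrite -(enum_rankK_in iu iu) coord_enum_val tnth_mktuple enum_rankK_in.
Qed.

End step_order.


(** * From a fixed history to an event determined by the history *)

Section histories.
Variables (R : realType) (dOmega : measure_display).
Variables (Omega : measurableType dOmega) (P : probability Omega R).
Variables (d r : nat) (X : construction R Omega d r).
Variables (f : d.-tuple R -> R[i]) (eps delta : R) (Gamma : {fset d.-tuple int}).
Local Notation I := (large_freqs delta f).
Hypotheses (eps0 : 0 < eps) (delta0 : 0 < delta) (r0 : (0 < r)%N).
Hypothesis IGamma : I `<=` [set` Gamma].
Hypothesis anchors : enough_anchors f eps delta r.
Hypothesis rc : random_construction X.

Let Ifin : finite_set I.
Proof. exact: sub_finite_set IGamma (finite_fset Gamma). Qed.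

(** The history as a value in a countable type, as [measure_le_fibers] requires; the tags
    accommodate the different types of the detected sets. *)
Definition history_code (u : {set 'I_d}) (w : Omega) : seq {v : {set 'I_d} & {fset #|v|.-tuple int}} :=
  [seq Tagged (fun v : {set 'I_d} => {fset #|v|.-tuple int}) (detected X v w) | v <- earlier u].

Lemma history_codeP (u : {set 'I_d}) w w0 :
  history_code u w = history_code u w0 <-> history X u (fun v => detected X v w0) w.
Proof.
split=> [/eq_in_map E v vu|H].
  by have /eqP := E v vu; rewrite eq_Tagged => /eqP.
by apply/eq_in_map => v vu; rewrite (H v vu).
Qed.

(** B is a union of histories, and the candidates are constant on each of them; [step_failure_le]
    applies to each history and the bounds add up. *)
Lemma failure_given_history u (B : set Omega) :
  u \in steps d -> valid_step P X f eps delta u -> measurable B ->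
  (forall w w0, B w0 -> history X u (fun v => detected X v w0) w ->
     B w /\ candidates X u w = candidates X u w0) ->
  (forall w, B w -> projection u I `<=` [set` candidates X u w]) ->
  (P (B `&` ~` detects X f delta u) <= (23 / 8 * eps)%:E * P B)%E.
Proof.
move=> us valid mB closed IB.
have codeE w0 : [set w | history_code u w = history_code u w0]
    = history X u (fun v => detected X v w0).
  by apply/seteqP; split=> w /= /history_codeP.
have mcode t : measurable [set w | history_code u w = t].
  have [[w0 <-]|no] := pselect (exists w0, history_code u w0 = t).
    by rewrite codeE; exact: measurable_history.
  rewrite (_ : [set w | _] = set0); first exact: measurable0.
  by apply/seteqP; split=> // w /= E; apply: no; exists w.
have mD : measurable (~` detects X f delta u).
  by apply: measurableC; exact: measurable_detects.
have c0 : 0 <= 23 / 8 * eps by rewrite mulr_ge0 // ltW.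
have := @measure_le_fibers _ _ _ P _ (history_code u) mcode (B `&` ~` detects X f delta u)
  B _ (measurableI _ _ mB mD) mB c0; apply=> w0 [Bw0 _].
rewrite codeE.
have -> : B `&` history X u (fun v => detected X v w0)
        = history X u (fun v => detected X v w0).
  by apply/seteqP; split=> [w []//|w H]; split=> //; case: (closed w w0 Bw0 H).
have -> : B `&` ~` detects X f delta u `&` history X u (fun v => detected X v w0)
        = history X u (fun v => detected X v w0) `&` ~` detects X f delta u.
  apply/seteqP; split=> [w [[_ ?] ?]//|w [H ?]]; do !split=> //.
  by case: (closed w w0 Bw0 H).
apply: (step_failure_le eps0 delta0 r0 Ifin anchors rc us valid (J := candidates X u w0)).
  by move=> w H; case: (closed w w0 Bw0 H).
exact: IB.
Qed.

Lemma set_fset_inj (T : choiceType) (A B : {fset T}) : [set` A] = [set` B] -> A = B.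
Proof.
move=> E; apply/fsetP => x; apply/idP/idP => xA.
  by have : [set` A] x by []; rewrite E.
by have : [set` B] x by []; rewrite -E.
Qed.

Lemma failure_part1 (t : 'I_d) : step_part1 P X f eps delta Gamma t ->
  (P (~` detects X f delta [set t]%SET) <= (23 / 8 * eps)%:E)%E.
Proof.
move=> [cand valid].
have := failure_given_history (set1_in_steps t) valid (@measurableT _ _).
rewrite setTI probability_setT mule1; apply.
- by move=> w w0 _ _; split=> //; apply: set_fset_inj; rewrite !cand.
- by move=> w _; rewrite cand; apply: image_subset.
Qed.

Definition previous_detects (t : 'I_d) :=
  detects X f delta (seg d t) `&` detects X f delta [set t]%SET.

Lemma measurable_detects_seg (t : 'I_d) : (0 < t)%N -> measurable (detects X f delta (seg d t)).
Proof.
move=> t0; apply: measurable_detects => //.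
have pd : (t.-1 < d)%N by apply: leq_ltn_trans (ltn_ord t); exact: leq_pred.
by have := seg_in_steps (Ordinal pd); rewrite /= prednK.
Qed.

Lemma measurable_previous_detects (t : 'I_d) : (0 < t)%N -> measurable (previous_detects t).
Proof.
move=> t0; apply: measurableI; first exact: measurable_detects_seg.
by apply: measurable_detects => //; exact: set1_in_steps.
Qed.

Lemma failure_part2 (t : 'I_d) : (0 < t)%N -> step_part2 P X f eps delta Gamma t ->
  (P (previous_detects t `&` ~` detects X f delta (seg d t.+1))
    <= (23 / 8 * eps)%:E * P (previous_detects t))%E.
Proof.
move=> t0 [cand valid]; have [e1 e2] := earlier_seg t0.
apply: failure_given_history => //.
- exact: seg_in_steps.
- exact: measurable_previous_detects.
- move=> w w0 [Bs Bt] H; have E1 := H _ e1; have E2 := H _ e2; split.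
    by split; rewrite /detects /= ?E1 ?E2.
  by apply: set_fset_inj; rewrite !cand E1 E2.
move=> w [Bs Bt] _ [l lI <-]; rewrite cand; split; last first.
  by exists l => //; exact: IGamma.
rewrite /product_set /= !restrict_freq_proj; last 2 first.
- by apply/fintype.subsetP => j; rewrite !inE => /eqP ->.
- by apply/fintype.subsetP => j; rewrite !inE => /leqW.
by apply/andP; split; [apply: Bs|apply: Bt]; exists l.
Qed.

Lemma success_detects u : thresholded X u -> success X f delta u = detects X f delta u.
Proof.
move=> thr; apply/seteqP; split=> [w []//|w D]; split=> // k /=.
by rewrite thr => /andP[].
Qed.

End histories.


(** The gap between a and b, such as 23/8 eps and 3 eps, makes the bound on success strict. *)
Lemma prob_lt_of_failure (R : realType) (dOmega : measure_display)
    (Omega : measurableType dOmega) (P : probability Omega R) (A : set Omega) (a b : R) :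
  measurable A -> (P (~` A) <= a%:E)%E -> a < b -> ((1 - b)%:E < P A)%E.
Proof.
move=> mA; have fin : P A \is a fin_num by exact: fin_num_measure.
rewrite probability_setC // -(fineK fin) -EFinB lee_fin lte_fin => h ab.
by rewrite ltrBlDr -ltrBlDl; apply: le_lt_trans ab.
Qed.

Theorem mainTheorem4 (R : realType) (dOmega : measure_display)
    (Omega : measurableType dOmega) (P : probability Omega R)
    (d : nat) (f : d.-tuple R -> R[i]) (eps delta : R)
    (Gamma : {fset d.-tuple int}) (r : nat) (X : construction R Omega d r) :
  (0 < d)%N -> torus_periodic f -> square_integrable f ->
  0 < eps -> 0 < delta ->
  large_freqs delta f `<=` [set` Gamma] ->
  (0 < r)%N -> enough_anchors f eps delta r ->
  random_construction X ->
  [/\ forall t : 'I_d,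
        step_part1 P X f eps delta Gamma t ->
        ((1 - 3 * eps)%:E < P (success X f delta [set t]%SET))%E,
      forall t : 'I_d, (0 < t)%N ->
        step_part2 P X f eps delta Gamma t ->
        let previous := detects X f delta (seg d t)
                        `&` detects X f delta [set t]%SET in
        (0 < P previous)%E ->
        1 - 3 * eps < cond_prob P (success X f delta (seg d t.+1)) previous
    & (forall t : 'I_d, step_part1 P X f eps delta Gamma t) ->
      (forall t : 'I_d, (0 < t)%N -> step_part2 P X f eps delta Gamma t) ->
      ((1 - 6 * d%:R * eps)%:E <
        P [set w | forall k, large_freqs delta f k ->
                     freq_proj (seg d d) k \in detected X (seg d d) w])%E].
Proof.
move=> d0 _ _ eps0 delta0 IGamma r0 anchors rc.
have c3 : 23 / 8 * eps < 3 * eps by rewrite ltr_pM2r //; lra.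
have fail1 t := @failure_part1 _ _ _ P _ _ X f eps delta Gamma eps0 delta0 r0 IGamma
  anchors rc t.
have fail2 t := @failure_part2 _ _ _ P _ _ X f eps delta Gamma eps0 delta0 r0 IGamma
  anchors rc t.
have mdet1 (t : 'I_d) : measurable (detects X f delta [set t]%SET).
  by apply: measurable_detects => //; exact: set1_in_steps.
have mdet2 (t : 'I_d) : measurable (detects X f delta (seg d t.+1)).
  by apply: measurable_detects => //; exact: seg_in_steps.
have fin A : measurable A -> P A \is a fin_num by move=> ?; exact: fin_num_measure.
split=> [t part1|t t0 part2 previous prev0|part1 part2].
- rewrite success_detects; last by case: part1 => _ [].
  exact: prob_lt_of_failure (mdet1 t) (fail1 t part1) c3.
- have mp : measurable previous by exact: measurable_previous_detects.
  have mD := mdet2 t.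
  rewrite success_detects; last by case: part2 => _ [].
  have h2 := fail2 t t0 part2; rewrite -/previous in h2.
  have mpD := measurableI _ _ mp mD.
  have mpC := measurableI _ _ mp (measurableC mD).
  have PE : P previous = (P (previous `&` detects X f delta (seg d t.+1))
      + P (previous `&` ~` detects X f delta (seg d t.+1)))%E.
    rewrite -measureU //; first by rewrite -setIUr setUv setIT.
    by rewrite setIACA setICr setI0.
  rewrite /cond_prob setIC.
  have p0 : 0 < fine (P previous) by rewrite fine_gt0 // prev0 ltey_eq fin.
  rewrite ltr_pdivlMr //.
  have sle : fine (P (previous `&` ~` detects X f delta (seg d t.+1)))
      <= 23 / 8 * eps * fine (P previous).
    by rewrite -lee_fin EFinM (fineK (fin _ mpC)) (fineK (fin _ mp)).
  move: (congr1 fine PE) p0 sle; rewrite fineD ?fin //.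
  move: (fine (P previous)) (fine (P (previous `&` _)))
    (fine (P (previous `&` ~` _))) => p q s -> qs0 sle.
  have : 23 / 8 * eps * (q + s) < 3 * eps * (q + s) by rewrite ltr_pM2r.
  by move: sle; lra.
have dd : (d.-1 < d)%N by rewrite prednK.
pose last : 'I_d := Ordinal dd.
have lastE : last.+1 = d by rewrite /= prednK.
have -> : [set w | forall k, large_freqs delta f k ->
     freq_proj (seg d d) k \in detected X (seg d d) w] = detects X f delta (seg d d).
  apply/seteqP; split=> w h; first by move=> _ [k kI <-]; exact: h.
  by move=> k kI; apply: h; exists k.
have mlast : measurable (detects X f delta (seg d d)).
  by have := mdet2 last; rewrite lastE.
(* First failures only: a step of part 2 counts when its predecessors succeeded, so its conditional
   bound applies, with P of the condition at most 1. Each t costs at most 2 * 23/8 eps = 23/4 eps <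
   6 eps. *)
pose bad (t : 'I_d) := ~` detects X f delta [set t]%SET `|`
  (if (0 < t)%N then previous_detects X f delta t
     `&` ~` detects X f delta (seg d t.+1) else set0).
have mbad2 (t : 'I_d) : measurable (if (0 < t)%N then previous_detects X f delta t
     `&` ~` detects X f delta (seg d t.+1) else set0).
  case: ifP => // t0; apply: measurableI; last exact: measurableC.
  exact: measurable_previous_detects.
have mbad t : measurable (bad t) by apply: measurableU => //; exact: measurableC.
have c0 : 0 <= 23 / 8 * eps by rewrite mulr_ge0 // ltW.
have Pbad t : (P (bad t) <= (23 / 4 * eps)%:E)%E.
  apply: le_trans (measureU2 _ _ _) _; [exact: measurableC|by []|].
  have -> : (23 / 4 * eps)%:E = ((23 / 8 * eps)%:E + (23 / 8 * eps)%:E)%E.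
    by rewrite -EFinD; congr (_%:E); field.
  apply: leeD; first exact: fail1.
  case: ifP => [t0|_]; last by rewrite measure0 lee_fin.
  apply: le_trans (fail2 t t0 (part2 t t0)) _.
  rewrite -[leRHS]mule1 lee_wpmul2l ?lee_fin //; apply: probability_le1.
  exact: measurable_previous_detects.
apply: (@prob_lt_of_failure _ _ _ _ _ (d%:R * (23 / 4 * eps))) => //; last first.
  have -> : 6 * d%:R * eps = d%:R * (6 * eps) by ring.
  by rewrite ltr_pM2l ?ltr0n // ltr_pM2r //; lra.
apply: (@le_trans _ _ (\sum_(t <- enum 'I_d) P (bad t))%E).
  apply: measure_le_sum => // [|w nd]; first exact: measurableC.
  apply: contrapT => good; apply: nd.
  have good1 t : detects X f delta [set t]%SET w.
    by apply: contrapT => h; apply: good; exists t; [rewrite mem_enum|left].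
  (* Outside all [bad t], detection passes from each initial segment to the next, starting with
     [seg d 1], which is a singleton. *)
  have good2 n : (n < d)%N -> detects X f delta (seg d n.+1) w.
    elim: n => [_|n IH nd].
      by rewrite (@seg1 _ (Ordinal d0)).
    apply: contrapT => h; apply: good; exists (Ordinal nd); first by rewrite mem_enum.
    right; split=> //; split; last exact: good1.
    by apply: IH; exact: ltnW.
  by have := good2 _ dd; rewrite prednK.
apply: (@le_trans _ _ (\sum_(t <- enum 'I_d) (23 / 4 * eps)%:E)%E).
  by apply: lee_sum => t _.
rewrite sumEFin lee_fin big_const_seq count_predT iter_addr_0 -cardE card_ord.
by rewrite -[leLHS]mulr_natl.
Qed.
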